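(* Let $(A,L,\partial,t)$ be an sh Lie-Rinehart algebra. For $j\ge1$, the derivation $\mathcal D_j=\partial^{t_j}+\partial^{*}_j$ of $\mathrm{Hom}(\mathrm S[sL],A)$ passes to a derivation of $\mathrm{Sym}_A(sL,A)=\mathrm{Hom}_A(\mathrm S_A[sL],A)$, and the resulting data $$(\mathrm{Sym}_A(sL,A),\mathcal D_0,\mathcal D_1,\mathcal D_2,\ldots)$$ constitute a multi derivation Maurer-Cartan algebra; that is, they form a multi derivation chain algebra.
   Context: Conventions. $R$ is a commutative ring containing $\mathbb Q$ as a subring; unadorned $\otimes$ and $\mathrm{Hom}$ are over $R$. Graded means $\mathbb Z$-graded (only homogeneous elements are considered); differentials have degree $-1$; the Eilenberg-Koszul sign convention is in force. The Hom-differential is $\mathcal D(f)=d\circ f+(-1)^{|f|+1}f\circ d$. $sL$ denotes the suspension of $L$ (regraded up by one). For a differential graded commutative $R$-algebra $A$, $\mathrm{Der}(A|R)$ is the differential graded $R$-Lie algebra of graded $R$-linear derivations of $A$. Coalgebra. $\mathrm S[sL]=\bigoplus_k\mathrm S^k[sL]$ is the graded symmetric $R$-algebra on $sL$, viewed as a coaugmented differential graded cocommutative $R$-coalgebra via the shuffle diagonal $\Delta$ (elements of $sL$ primitive); since $R\supseteq\mathbb Q$, it is canonically the cofree graded cocommutative coalgebra on $sL$. Its differential $d^0$ is induced from that of $L$, and its coaugmentation filtration is $C_j=\bigoplus_{k\le j}\mathrm S^k[sL]$. An sh Lie algebra structure on a chain complex $L$ over $R$ is a coderivation $\partial$ of degree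 $-1$ on $\mathrm S[sL]$ lowering the coaugmentation filtration such that $(d^0+\partial)^2=0$. Write $\partial=\partial^1+\partial^2+\cdots$, where $\partial^j$ is the coderivation determined by the constituent $\partial\colon\mathrm S^{j+1}[sL]\to sL$. An sh-action of $(L,\partial)$ on $A$ by derivations is a Lie algebra twisting cochain $t\colon(\mathrm S[sL],d^0+\partial)\to\mathrm{Der}(A|R)$, i.e. a degree $-1$ $R$-module morphism vanishing on the image of the coaugmentation with $\mathcal Dt+t\wedge t=0$, where $\mathcal Dt$ is the Hom-differential formed with $d^0+\partial$, $t\wedge t=\tfrac12[t,t]$ and $[f,g]=[\cdot,\cdot]\circ(f\otimes g)\circ\Delta$. Write $t=t_1+t_2+\cdots$, where $t_j$ is the component defined on $\mathrm S^j[sL]$. sh Lie-Rinehart algebra. Data $(A,L,\partial,t)$ with $A$ a differential graded commutative $R$-algebra, $(L,\partial)$ an sh Lie algebra over $R$ carrying also a differential graded $A$-module structure (so $sL$ is a differential graded $A$-module), and $t$ an sh-action of $(L,\partial)$ on $A$ by derivations, such that $t$ is graded $A$-multilinear (each $t_j$ is graded $A$-multilinear, e.g. $t_j(a\alpha_1,\ldots,\alpha_j)=(-1)^{|a|}a\,t_j(\alpha_1,\ldots,\alpha_j)$) and, for all $j\ge1$ and homogeneous $\alpha_1,\ldots,\alpha_{j+1}\in sL$, $a\in A$, $$\partial^j(\alpha_1,\ldots,\alpha_j,a\alpha_{j+1})=t_j(\alpha_1,\ldots,\alpha_j)(a)\,\alpha_{j+1}+(-1)^{(|\alpha_1|+\cdots+|\alpha_j|+1)|a|}a\,\partial^j(\alpha_1,\ldots,\alpha_j,\alpha_{j+1}),$$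 where $\partial^j$ denotes the constituent $\mathrm S^{j+1}[sL]\to sL$. Derivations. $\mathrm{Hom}(\mathrm S[sL],A)$ is a differential graded commutative algebra under the cup product and the Hom-differential $\mathcal D_0$ (formed with $d^0$ and the differential of $A$). For $j\ge1$, $\partial^{*}_j(\varphi)=(-1)^{|\varphi|+1}\varphi\circ\partial^j$, and $\partial^{t_j}(\varphi)=[t_j,\varphi]$ is the composite of $\Delta$, $t_j\otimes\varphi$, and the evaluation $\mathrm{Der}(A|R)\otimes A\to A$. $\mathrm{Sym}_A(sL,A)=\mathrm{Hom}_A(\mathrm S_A[sL],A)$, with $\mathrm S_A[sL]$ the graded symmetric $A$-algebra on $sL$, is the subalgebra of $\mathrm{Hom}(\mathrm S[sL],A)$ of those forms that are graded $A$-multilinear on each $\mathrm S^k[sL]$, $k\ge1$ (the degree $k=0$ part being $A$); it is preserved by $\mathcal D_0$. A derivation of $\mathrm{Hom}(\mathrm S[sL],A)$ passes to $\mathrm{Sym}_A(sL,A)$ if it maps this subalgebra to itself. $\mathrm{Sym}_A(sL,A)$ is filtered by $\mathrm{Sym}_A(sL,A)^{j}=\{\text{forms vanishing on }C_{j-1}\}$, $j\ge0$ ($C_{-1}=0$). A multi derivation chain algebra is a differential graded commutative algebra $(\mathcal A,\mathcal D_0)$ with a descending filtration $\mathcal A=\mathcal A^0\supseteq\mathcal A^1\supseteq\cdots$ compatible with $\mathcal D_0$ and with degree $-1$ $R$-linear derivations $\mathcal D_j$ ($j\ge1$) such that each $\mathcal D_j$, when non-zero, lowers the filtration by $j$ ($\mathcal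 D_j(\mathcal A^\ell)\subseteq\mathcal A^{\ell+j}$ for all $\ell\geq 0$) but not by $j+1$, such that $\sum_{j\ge 1}\mathcal D_j$ converges (naively, or with respect to the filtration when it is complete), and such that $\sum_{j\ge0}\mathcal D_j$ is a differential. A multi derivation Maurer-Cartan algebra is a multi derivation chain algebra of the form $(\mathrm{Sym}_A(sL,A),\mathcal D_0,\mathcal D_1,\ldots)$ obtained in this way from $(\partial,t)$. *)

(* Defs.v *)
From HB Require Import structures.
From mathcomp Require Import all_boot all_order all_algebra.
From mathcomp Require Import boolp classical_sets functions.
From mathcomp Require Import zify ring.

Set Implicit Arguments.
Unset Strict Implicit.
Unset Printing Implicit Defensive.

Import GRing.Theory.
Local Open Scope ring_scope.
Local Open Scope quotient_scope.

Section Presented.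
Context (R : comNzRingType) (X : choiceType).

(* A formal R-linear combination of elements of X is a list of pairs
   (coefficient, generator). *)
Definition feval (M : lmodType R) (f : X -> M) (s : seq (R * X)) : M :=
  \sum_(p <- s) p.1 *: f p.2.

Context (rel : seq (R * X) -> Prop).

Definition kills (M : lmodType R) (f : X -> M) : Prop :=
  forall s, rel s -> feval f s = 0.

(* Two formal combinations are congruent modulo the submodule generated by the
   relations iff no linear map out of the free module that kills the relations
   separates them. *)
Definition fcong (s s' : seq (R * X)) : bool :=
  `[< forall (M : lmodType R) (f : X -> M), kills f -> feval f s = feval f s' >].

Lemma fcong_refl : reflexive fcong.
Proof. by move=> s; apply/asboolP. Qed.

Lemma fcong_sym : symmetric fcong.
Proof.
move=> s s'; apply/asboolP/asboolP => h M f k; exact/esym/h.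
Qed.

Lemma fcong_trans : transitive fcong.
Proof.
move=> s s' s'' /asboolP h /asboolP h'; apply/asboolP => M f k.
by rewrite h // h'.
Qed.

Canonical fcong_equiv := EquivRel fcong fcong_refl fcong_sym fcong_trans.

Definition presented := {eq_quot fcong}.
HB.instance Definition _ := Choice.on presented.
HB.instance Definition _ := EqQuotient.on presented.

Definition pclass (s : seq (R * X)) : presented := \pi_presented s.

Definition gen (x : X) : presented := pclass [:: (1, x)].

(* The linear extension of f to the quotient; it is meaningful when f kills the
   relations (linextE, linext_linear). *)
Definition linext (M : lmodType R) (f : X -> M) (x : presented) : M :=
  feval f (repr x).

Definition fscale (a : R) (s : seq (R * X)) : seq (R * X) :=
  [seq (a * p.1, p.2) | p <- s].

Lemma feval_cat (M : lmodType R) (f : X -> M) s s' :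
  feval f (s ++ s') = feval f s + feval f s'.
Proof. by rewrite /feval big_cat. Qed.

Lemma feval_scale (M : lmodType R) (f : X -> M) a s :
  feval f (fscale a s) = a *: feval f s.
Proof.
by rewrite /feval big_map scaler_sumr; apply: eq_bigr => p _; rewrite scalerA.
Qed.

Lemma pclassP s s' : pclass s = pclass s' <->
  (forall (M : lmodType R) (f : X -> M), kills f -> feval f s = feval f s').
Proof.
split=> [/eqmodP/asboolP //| h]; exact/eqmodP/asboolP.
Qed.

Lemma linext_pclass (M : lmodType R) (f : X -> M) s :
  kills f -> linext f (pclass s) = feval f s.
Proof. by move=> k; have /pclassP := reprK (pclass s); apply. Qed.

Definition padd (x y : presented) := pclass (repr x ++ repr y).
Definition pscale (a : R) (x : presented) := pclass (fscale a (repr x)).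
Definition popp (x : presented) := pscale (-1) x.

Lemma paddE s s' : padd (pclass s) (pclass s') = pclass (s ++ s').
Proof.
apply/pclassP => M f k; rewrite !feval_cat.
by rewrite -!/(linext f _) !linext_pclass.
Qed.

Lemma pscaleE a s : pscale a (pclass s) = pclass (fscale a s).
Proof.
by apply/pclassP => M f k; rewrite !feval_scale -!/(linext f _) !linext_pclass.
Qed.

Lemma pclassW (P : presented -> Prop) : (forall s, P (pclass s)) -> forall x, P x.
Proof. by move=> h x; rewrite -[x]reprK; apply: h. Qed.

Lemma paddA : associative padd.
Proof.
elim/pclassW=> s; elim/pclassW=> s'; elim/pclassW=> s''.
by rewrite !paddE catA.
Qed.

Lemma paddC : commutative padd.
Proof.
elim/pclassW=> s; elim/pclassW=> s'; rewrite !paddE.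
by apply/pclassP => M f _; rewrite !feval_cat addrC.
Qed.

Lemma padd0 : left_id (pclass [::]) padd.
Proof. by elim/pclassW=> s; rewrite paddE. Qed.

Lemma paddN : left_inverse (pclass [::]) popp padd.
Proof.
elim/pclassW=> s; rewrite /popp pscaleE paddE; apply/pclassP => M f _.
by rewrite feval_cat feval_scale scaleN1r addNr /feval big_nil.
Qed.

HB.instance Definition _ :=
  GRing.isZmodule.Build presented paddA paddC padd0 paddN.

Lemma pscaleA a b x : pscale a (pscale b x) = pscale (a * b) x.
Proof.
elim/pclassW: x => s; rewrite !pscaleE; apply/pclassP => M f _.
by rewrite !feval_scale scalerA.
Qed.

Lemma pscale1 : left_id 1 pscale.
Proof.
elim/pclassW=> s; rewrite pscaleE; apply/pclassP => M f _.
by rewrite feval_scale scale1r.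
Qed.

Lemma pscaleDr : right_distributive pscale +%R.
Proof.
move=> a; elim/pclassW=> s; elim/pclassW=> s'.
rewrite [X in pscale _ X]paddE !pscaleE [RHS]paddE; apply/pclassP => M f _.
by rewrite !(feval_scale, feval_cat) scalerDr.
Qed.

Lemma pscaleDl x : {morph pscale^~ x : a b / a + b}.
Proof.
move=> a b; elim/pclassW: x => s; rewrite !pscaleE [RHS]paddE.
by apply/pclassP => M f _; rewrite !(feval_scale, feval_cat) scalerDl.
Qed.

HB.instance Definition _ :=
  GRing.Zmodule_isLmodule.Build R presented pscaleA pscale1 pscaleDr pscaleDl.

Lemma linextE (M : lmodType R) (f : X -> M) x : kills f -> linext f (gen x) = f x.
Proof.
by move=> k; rewrite linext_pclass // /feval big_seq1 scale1r.
Qed.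

Lemma linext_linear (M : lmodType R) (f : X -> M) : kills f -> linear (linext f).
Proof.
move=> k a; elim/pclassW=> s; elim/pclassW=> s'.
rewrite [_ *: _]pscaleE [X in linext f X]paddE !linext_pclass //.
by rewrite feval_cat feval_scale.
Qed.

Lemma gen_kills : kills gen.
Proof.
have E s : feval gen s = pclass s.
  elim: s => [|[a x] s IH]; first by rewrite /feval big_nil.
  rewrite /feval big_cons -/(feval gen s) IH /= [_ *: _]pscaleE [LHS]paddE.
  by apply/pclassP => M f _; rewrite /feval /= !big_cons mulr1.
move=> s rs; rewrite E; apply/pclassP => M f k.
by rewrite (k _ rs) /feval big_nil.
Qed.

Definition pspan (Q : X -> Prop) (x : presented) : Prop :=
  exists s : seq (R * X),
    (forall p, p \in s -> Q p.2) /\ x = \sum_(p <- s) p.1 *: gen p.2.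

Lemma pspan0 Q : pspan Q 0.
Proof. by exists [::]; split=> //; rewrite big_nil. Qed.

Lemma pspanD Q a x y : pspan Q x -> pspan Q y -> pspan Q (a *: x + y).
Proof.
move=> [s [Qs ->]] [s' [Qs' ->]]; exists (fscale a s ++ s'); split.
  move=> p; rewrite mem_cat => /orP[/mapP[q qs ->]|]; [exact: (Qs q qs)|exact: Qs'].
rewrite big_cat big_map scaler_sumr; congr (_ + _).
by apply: eq_bigr => p _; rewrite scalerA.
Qed.

End Presented.

Definition sgn {R : comNzRingType} (n : int) : R := (-1) ^+ `|n|%N.

(* A graded module is a family of submodules (gpc n)_n of an ambient module;
   only its homogeneous elements matter.  When the ambient module is moreover
   the direct sum of the family, gdirect holds. *)
Record gmod (R : comNzRingType) := Gmod {
  gcar :> lmodType R;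
  gpc : int -> gcar -> Prop;
  gpc0 : forall n, gpc n 0;
  gpcD : forall n a x y, gpc n x -> gpc n y -> gpc n (a *: x + y)
}.
Arguments gpc {R} _ _ _.
Arguments gpc0 {R} _ _.

Record gdirect (R : comNzRingType) (M : gmod R) : Prop := {
  gdirect_span : forall x : M, exists (s : seq int) (f : int -> M),
    (forall i, gpc M i (f i)) /\ x = \sum_(i <- s) f i;
  gdirect_free : forall (s : seq int) (f : int -> M),
    uniq s -> (forall i, gpc M i (f i)) -> \sum_(i <- s) f i = 0 ->
    forall i, i \in s -> f i = 0
}.

Section Letters.
Context {R : comNzRingType} {M : gmod R}.

Record letter := Letter {
  lpair : int * M;
  letterP : `[< gpc M lpair.1 lpair.2 >]
}.
HB.instance Definition _ := [isSub for lpair].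
HB.instance Definition _ := [Choice of letter by <:].

Definition ldeg (x : letter) : int := (lpair x).1.
Definition lval (x : letter) : M := (lpair x).2.

Definition letter0 (n : int) : letter := @Letter (n, 0) (asboolT (gpc0 M n)).

(* v as a homogeneous element of degree n (the zero element of degree n if v is
   not of that degree). *)
Definition lett (n : int) (v : M) : letter := insubd (letter0 n) (n, v).

Lemma lval_gpc (x : letter) : gpc M (ldeg x) (lval x).
Proof. exact/asboolP/(letterP x). Qed.

Lemma lettE (n : int) (v : M) :
  gpc M n v -> ldeg (lett n v) = n /\ lval (lett n v) = v.
Proof.
move=> h; rewrite /ldeg /lval.
by have -> : lpair (lett n v) = (n, v) by apply/insubdK/asboolP.
Qed.

Definition llin (a : R) (x y z : letter) : Prop :=
  [/\ ldeg y = ldeg x, ldeg z = ldeg x & lval z = a *: lval x + lval y].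

Definition wdeg (w : seq letter) : int := \sum_(x <- w) ldeg x.

End Letters.
Arguments letter {R} M.

Section Tensor.
Context {R : comNzRingType}.

Inductive tensrel (M N : gmod R) : seq (R * (letter M * letter N)) -> Prop :=
| tensrel_l a x x' z y of llin a x x' z :
    tensrel [:: (1, (z, y)); (- a, (x, y)); (-1, (x', y))]
| tensrel_r a x y y' z of llin a y y' z :
    tensrel [:: (1, (x, z)); (- a, (x, y)); (-1, (x, y'))].

Definition tensor (M N : gmod R) := presented (@tensrel M N).
HB.instance Definition _ (M N : gmod R) := GRing.Lmodule.on (tensor M N).

Definition tens (M N : gmod R) (x : letter M) (y : letter N) : tensor M N :=
  gen _ (x, y).

Definition tlift (M N : gmod R) (P : lmodType R)
    (b : letter M -> letter N -> P) : tensor M N -> P :=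
  linext (fun p => b p.1 p.2).

(* f (x) g for f of degree m and g of degree n, with the Koszul sign. *)
Definition tmap (M N M' N' : gmod R) (m n : int) (f : M -> M') (g : N -> N') :
    tensor M N -> tensor M' N' :=
  tlift (fun x y => sgn (n * ldeg x) *:
    tens (lett (ldeg x + m) (f (lval x))) (lett (ldeg y + n) (g (lval y)))).

End Tensor.

Section SymmetricCoalgebra.
Context {R : comNzRingType}.

Inductive symrel (V : gmod R) : seq (R * seq (letter V)) -> Prop :=
| symrel_lin u v a x y z of llin a x y z :
    symrel [:: (1, u ++ z :: v); (- a, u ++ x :: v); (-1, u ++ y :: v)]
| symrel_comm u v x y :
    symrel [:: (1, u ++ [:: x, y & v]);
               (- sgn (ldeg x * ldeg y), u ++ [:: y, x & v])].

Definition symalg (V : gmod R) := presented (@symrel V).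
HB.instance Definition _ (V : gmod R) := GRing.Lmodule.on (symalg V).

Section V.
Context (V : gmod R).
Implicit Types u v w : seq (letter V).

Definition sprod w : symalg V := gen _ w.

Definition sdeg (n : int) (x : symalg V) : Prop :=
  pspan (fun w => wdeg w = n) x.

Definition symg : gmod R :=
  @Gmod R (symalg V) sdeg (fun n => pspan0 _ _)
    (fun n a x y => @pspanD _ _ _ _ a x y).

Definition coaug (j : int) (x : symg) : Prop :=
  pspan (fun w => ((size w)%:Z <= j)%R) x.

Definition wproj (k : nat) : symg -> symg :=
  linext (fun w => if size w == k then sprod w else 0).

(* The projection of S[V] onto S^1[V] = V. *)
Definition corest : symg -> V :=
  linext (fun w => if w is [:: x] then lval x else 0).

(* The pairs of complementary subwords of w, with their Koszul signs. *)
Fixpoint unshuffle w : seq (R * (seq (letter V) * seq (letter V))) :=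
  if w is x :: w' then
    [seq (p.1, (x :: p.2.1, p.2.2)) | p <- unshuffle w'] ++
    [seq (p.1 * sgn (ldeg x * wdeg p.2.1), (p.2.1, x :: p.2.2))
      | p <- unshuffle w']
  else [:: (1, ([::], [::]))].

Definition sletter w : letter symg := @lett R symg (wdeg w) (sprod w).

Definition diag : symg -> tensor symg symg :=
  linext (fun w => \sum_(p <- unshuffle w)
    p.1 *: tens (sletter p.2.1) (sletter p.2.2)).

Definition is_coderivation (f : symg -> symg) : Prop :=
  forall x, diag (f x) =
    tmap (-1) 0 f (fun y => y) (diag x) + tmap 0 (-1) (fun y => y) f (diag x).

(* The coderivation of degree -1 determined by the constituent
   c : S^k[V] -> V. *)
Definition coder (k : nat) (c : seq (letter V) -> V) : symg -> symg :=
  linext (fun w => \sum_(p <- unshuffle w | size p.2.1 == k)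
    p.1 *: sprod (lett (wdeg p.2.1 - 1) (c p.2.1) :: p.2.2)).

End V.
End SymmetricCoalgebra.

Section GradedAlgebra.
Context {R : comNzRingType} (E : gmod R).
(* The operations of a graded algebra are families indexed by the degrees of
   their arguments: mul i j is the restriction of the product to E_i x E_j, and
   D i that of an operator D to E_i. *)
Context (mul : int -> int -> E -> E -> E) (one : E).

Record is_gcalgebra : Prop := {
  gcalg_deg : forall i j x y, gpc E i x -> gpc E j y ->
    gpc E (i + j) (mul i j x y);
  gcalg_linl : forall i j a x x' y, gpc E i x -> gpc E i x' -> gpc E j y ->
    mul i j (a *: x + x') y = a *: mul i j x y + mul i j x' y;
  gcalg_linr : forall i j a x y y', gpc E i x -> gpc E j y -> gpc E j y' ->
    mul i j x (a *: y + y') = a *: mul i j x y + mul i j x y';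
  gcalg_assoc : forall i j k x y z, gpc E i x -> gpc E j y -> gpc E k z ->
    mul i (j + k) x (mul j k y z) = mul (i + j) k (mul i j x y) z;
  gcalg_one : gpc E 0 one;
  gcalg_unit : forall i x, gpc E i x -> mul 0 i one x = x;
  gcalg_comm : forall i j x y, gpc E i x -> gpc E j y ->
    mul i j x y = sgn (i * j) *: mul j i y x
}.

Record is_glinear (k : int) (D : int -> E -> E) : Prop := {
  glin_deg : forall i x, gpc E i x -> gpc E (i + k) (D i x);
  glin_lin : forall i a x y, gpc E i x -> gpc E i y ->
    D i (a *: x + y) = a *: D i x + D i y
}.

Record is_derivation (k : int) (D : int -> E -> E) : Prop := {
  der_linear : is_glinear k D;
  der_leibniz : forall i j x y, gpc E i x -> gpc E j y ->
    D (i + j) (mul i j x y) =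
      mul (i + k) j (D i x) y + sgn (k * i) *: mul i (j + k) x (D j y)
}.

Record is_differential (D : int -> E -> E) : Prop := {
  diff_linear : is_glinear (-1) D;
  diff_sq : forall i x, gpc E i x -> D (i - 1) (D i x) = 0
}.

Record is_cdga (d : int -> E -> E) : Prop := {
  cdga_alg : is_gcalgebra;
  cdga_der : is_derivation (-1) d;
  cdga_diff : is_differential d
}.

End GradedAlgebra.

Record complex (R : comNzRingType) := Complex {
  cx_mod :> gmod R;
  cx_direct : gdirect cx_mod;
  cx_d : cx_mod -> cx_mod;
  cx_lin : linear cx_d;
  cx_diff : is_differential (fun=> cx_d)
}.
Arguments cx_d {R c}.

Lemma cx_dN (R : comNzRingType) (M : complex R) (x : M) :
  cx_d (- x) = - cx_d x.
Proof.
have d0 : cx_d (0 : M) = 0.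
  by have := cx_lin (-1 : R) (0 : M) 0; rewrite scaler0 addr0 scaleN1r addNr.
by have := cx_lin (-1 : R) x 0; rewrite !addr0 d0 addr0 !scaleN1r.
Qed.

Record cdga (R : comNzRingType) := Cdga {
  cdga_cx :> complex R;
  cmul : cdga_cx -> cdga_cx -> cdga_cx;
  cone : cdga_cx;
  cmul_linl : forall b, linear (cmul^~ b);
  cmul_linr : forall a, linear (cmul a);
  cdgaP : is_cdga (fun _ _ => cmul) cone (fun=> cx_d)
}.
Arguments cmul {R c}.
Arguments cone {R c}.

Record is_dgmodule (R : comNzRingType) (A : cdga R) (L : complex R)
    (act : A -> L -> L) : Prop := {
  dgm_linl : forall x, linear (act^~ x);
  dgm_linr : forall a, linear (act a);
  dgm_unit : forall x, act cone x = x;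
  dgm_assoc : forall a b x, act a (act b x) = act (cmul a b) x;
  dgm_deg : forall i j a x, gpc A i a -> gpc L j x -> gpc L (i + j) (act a x);
  dgm_d : forall i a x, gpc A i a ->
    cx_d (act a x) = act (cx_d a) x + sgn i *: act a (cx_d x)
}.

Section Suspension.
Context {R : comNzRingType} (L : complex R).

Definition susp_gmod : gmod R :=
  @Gmod R L (fun n => gpc L (n - 1)) (fun n => gpc0 L (n - 1))
    (fun n a x y => @gpcD R L (n - 1) a x y).

Lemma susp_direct : gdirect susp_gmod.
Proof.
have [hs hf] := cx_direct L; split=> [x|s f us fs s0 i si].
  have [s [f [fs ->]]] := hs x.
  exists [seq i + 1 | i <- s], (fun n => f (n - 1)); split=> [i|]; first exact: fs.
  by rewrite big_map; apply: eq_bigr => i _; rewrite addrK.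
rewrite -[i](subrK 1).
apply: (hf [seq i - 1 | i <- s] (fun n => f (n + 1))).
- by rewrite map_inj_uniq // => k l /addIr.
- by move=> k; have := fs (k + 1); rewrite /= addrK.
- by rewrite big_map -[RHS]s0; apply: eq_bigr => k _; rewrite subrK.
- exact: map_f.
Qed.

Definition susp_d (x : susp_gmod) : susp_gmod := - (cx_d (x : L)).

Lemma susp_lin : linear susp_d.
Proof. by move=> a x y; rewrite /susp_d cx_lin opprD scalerN. Qed.

Lemma susp_diff : is_differential (fun=> susp_d).
Proof.
have [[hd hl] hq] := cx_diff L.
split=> [|i x hx]; last first.
  by rewrite /susp_d (cx_dN (cx_d (x : L))) (hq _ _ hx) !oppr0.
split=> [i x hx|i a x y _ _]; last exact: susp_lin.
have := gpcD (-1) (hd _ _ hx) (gpc0 L _).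
by rewrite addr0 scaleN1r.
Qed.

(* The suspension sL: same underlying module, degrees raised by one; the sign of
   the differential is dictated by d s = - s d. *)
Definition susp : complex R := Complex susp_direct susp_lin susp_diff.

(* The A-action on sL, a (s x) = (-1)^|a| s (a x), for a of degree i. *)
Definition sact (A : cdga R) (act : A -> L -> L) (i : int) (a : A) (x : susp) :
    susp := sgn i *: act a x.

Definition lact (A : cdga R) (act : A -> L -> L) (a : letter A)
    (x : letter susp) : letter susp :=
  @lett R susp (ldeg a + ldeg x) (sact act (ldeg a) (lval a) (lval x)).

End Suspension.

Section DerHom.
Context {R : comNzRingType}.

Definition hom_deg (M N : gmod R) (n : int) (f : M -> N) : Prop :=
  linear f /\ forall i x, gpc M i x -> gpc N (i + n) (f x).

Lemma hom_deg0 (M N : gmod R) n : @hom_deg M N n 0.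
Proof.
split=> [a x y|i x _]; [by rewrite scaler0 addr0|exact: gpc0].
Qed.

Lemma hom_degD (M N : gmod R) n a (f g : M -> N) :
  hom_deg n f -> hom_deg n g -> hom_deg n (a *: f + g).
Proof.
move=> [lf df] [lg dg]; split=> [b x y|i x hx].
  rewrite !fctE lf lg !scalerDr !scalerA [a * b]mulrC.
  by rewrite -!addrA; congr (_ + _); rewrite addrCA.
by apply: gpcD; [exact: df|exact: dg].
Qed.

Definition homg (M N : gmod R) : gmod R :=
  @Gmod R (M -> N : Type) _ (@hom_deg0 M N) (@hom_degD M N).

(* The Hom-differential on maps f of degree n. *)
Definition hom_d (M N : gmod R) (dM : M -> M) (dN : N -> N) (n : int)
    (f : M -> N) : M -> N :=
  fun x => dN (f x) + sgn (n + 1) *: f (dM x).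

Context (A : cdga R).

Definition der_deg (n : int) (f : A -> A) : Prop :=
  hom_deg n f /\ forall i a b, gpc A i a ->
    f (cmul a b) = cmul (f a) b + sgn (n * i) *: cmul a (f b).

Lemma der_deg0 n : der_deg n 0.
Proof.
split=> [|i a b _]; first exact: hom_deg0.
have m0 c : cmul 0 c = 0 :> A.
  by have := cmul_linl c (-1) 0 0; rewrite /= scaler0 addr0 scaleN1r addNr.
have m0' c : cmul c 0 = 0 :> A.
  by have := cmul_linr c (-1) 0 0; rewrite /= scaler0 addr0 scaleN1r addNr.
by rewrite [LHS]/= -[(0 : A -> A) a]/(0 : A) -[(0 : A -> A) b]/(0 : A) m0 m0' scaler0 addr0.
Qed.

Lemma der_degD n a f g : der_deg n f -> der_deg n g -> der_deg n (a *: f + g).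
Proof.
move=> [hf lf] [hg lg]; split=> [|i b c hb]; first exact: hom_degD.
change (a *: f (cmul b c) + g (cmul b c) = cmul (a *: f b + g b) c
  + sgn (n * i) *: cmul b (a *: f c + g c)).
have := cmul_linl c a (f b) (g b); have := cmul_linr b a (f c) (g c).
rewrite /= (lf _ _ _ hb) (lg _ _ _ hb) => -> ->.
rewrite !scalerDr !scalerA [a * _]mulrC.
by rewrite -!addrA; congr (_ + _); rewrite addrCA.
Qed.

Definition Der : gmod R := @Gmod R (A -> A : Type) _ der_deg0 der_degD.

Definition der_bracket (f g : letter Der) : Der :=
  (fun a => lval f (lval g a)
            - sgn (ldeg f * ldeg g) *: lval g (lval f a)).

End DerHom.

Section MultiDerivation.
Context {R : comNzRingType} (E : gmod R).
Context (mul : int -> int -> E -> E -> E) (one : E).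
(* D 0 is the differential, D j for j >= 1 the higher derivations, and F l the
   filtration. *)
Context (D : nat -> int -> E -> E) (F : nat -> E -> Prop).

Record is_filtration : Prop := {
  filt_sub0 : forall l, F l 0;
  filt_subD : forall l i a x y, gpc E i x -> gpc E i y ->
    F l x -> F l y -> F l (a *: x + y);
  filt_full : forall i x, gpc E i x -> F 0 x;
  filt_desc : forall l i x, gpc E i x -> F l.+1 x -> F l x;
  filt_diff : forall l i x, gpc E i x -> F l x -> F l (D 0 i x)
}.

Definition filt_limit (u : nat -> E) (x : E) : Prop :=
  forall l, exists N, forall k, (N <= k)%N -> F l (x - u k).

Definition filt_complete : Prop :=
  (forall i x, gpc E i x -> (forall l, F l x) -> x = 0) /\
  (forall i (u : nat -> E), (forall k, gpc E i (u k)) ->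
    (forall l, exists N, forall k, (N <= k)%N -> F l (u k - u N)) ->
    exists2 x, gpc E i x & filt_limit u x).

Definition lowers_by (k : nat) (f : int -> E -> E) : Prop :=
  forall l i x, gpc E i x -> F l x -> F (l + k)%N (f i x).

Definition partial_sum (i : int) (x : E) (n : nat) : E :=
  \sum_(j < n) D j i x.

(* T is the sum of the D j, taken elementwise as a finite sum or as a limit in
   the filtration topology. *)
Definition is_sum (T : int -> E -> E) : Prop :=
  (forall i x, gpc E i x ->
    exists N, forall n, (N <= n)%N -> T i x = partial_sum i x n) \/
  (filt_complete /\
    forall i x, gpc E i x -> filt_limit (partial_sum i x) (T i x)).

Record is_multi_derivation_chain_algebra : Prop := {
  mdca_cdga : is_cdga mul one (D 0);
  mdca_filt : is_filtration;
  mdca_der : forall j, (0 < j)%N -> is_derivation mul (-1) (D j);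
  mdca_lower : forall j, (0 < j)%N -> lowers_by j (D j);
  mdca_strict : forall j, (0 < j)%N ->
    (exists i x, gpc E i x /\ D j i x <> 0) -> ~ lowers_by j.+1 (D j);
  mdca_sum : exists T, is_sum T /\ is_differential T
}.

End MultiDerivation.

Section ShLie.
Context {R : comNzRingType} (L : complex R).
Local Notation V := (susp L).
Local Notation S := (symg V).

Definition d0 : S -> S :=
  coder 1 (fun w => if w is [:: x] then cx_d (lval x) else 0).

Record is_shLie (pd : S -> S) : Prop := {
  shl_deg : hom_deg (-1) pd;
  shl_coder : is_coderivation pd;
  shl_lower : forall (j : int) x, coaug j x -> coaug (j - 1) (pd x);
  shl_sq : forall x, d0 (d0 x + pd x) + pd (d0 x + pd x) = 0
}.

(* The constituents of pd, for all lengths at once. *)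
Definition constituent (pd : S -> S) (w : seq (letter V)) : V :=
  corest (pd (sprod w)).

Definition pd_ (pd : S -> S) (j : nat) : S -> S := coder j.+1 (constituent pd).

Context (A : cdga R).

(* The composite of the diagonal, f (x) g and a pairing, for f of degree m and g
   of degree n. *)
Definition convolve (M N : gmod R) (P : lmodType R)
    (b : letter M -> letter N -> P) (m n : int) (f : S -> M) (g : S -> N) :
    S -> P :=
  fun x => tlift b (tmap m n f g (diag x)).

Definition eval_pairing (f : letter (Der A)) (a : letter A) : A :=
  lval f (lval a).

Definition mul_pairing (a b : letter A) : A := cmul (lval a) (lval b).

(* t /\ t = 1/2 [t, t].  The ring morphism iota, injective since rat is a field
   and R is non-trivial, exhibits Q as a subring of R. *)
Definition wedge (iota : {rmorphism rat -> R}) (t : S -> Der A) : S -> Der A :=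
  fun x => iota (2%:R^-1) *: convolve (@der_bracket R A) (-1) (-1) t t x.

(* In shact_MC, the first two summands are D t, with t x of degree n - 1 for x
   of degree n. *)
Record is_shaction (iota : {rmorphism rat -> R}) (pd : S -> S)
    (t : S -> Der A) : Prop := {
  shact_deg : hom_deg (-1) t;
  shact_coaug : t (sprod [::]) = 0;
  shact_MC : forall n x, gpc S n x ->
    hom_d cx_d cx_d (n - 1) (t x) + t (d0 x + pd x) + wedge iota t x = 0
}.

Definition t_ (t : S -> Der A) (j : nat) : S -> Der A :=
  fun x => t (wproj j x).

Context (act : A -> L -> L).

(* f of degree m is graded A-multilinear, M being an A-module via am. *)
Definition amultilinear (M : lmodType R) (am : A -> M -> M) (m : int)
    (f : S -> M) : Prop :=
  forall u v a x,
    f (sprod (u ++ lact act a x :: v)) =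
      sgn (ldeg a * (m + wdeg u)) *: am (lval a) (f (sprod (u ++ x :: v))).

Definition der_act (a : A) (f : Der A) : Der A := (fun b => cmul a (f b)).

Record is_shLR (iota : {rmorphism rat -> R}) (pd : S -> S) (t : S -> Der A) :
    Prop := {
  shlr_module : is_dgmodule act;
  shlr_shLie : is_shLie pd;
  shlr_shaction : is_shaction iota pd t;
  shlr_multilinear : forall j, (0 < j)%N -> amultilinear der_act (-1) (t_ t j);
  shlr_leibniz : forall (w : seq (letter V)) (a : letter A) (x : letter V),
    (0 < size w)%N ->
    constituent pd (rcons w (lact act a x)) =
      sact act (wdeg w - 1 + ldeg a) (t_ t (size w) (sprod w) (lval a)) (lval x)
      + sgn ((wdeg w + 1) * ldeg a) *:
          sact act (ldeg a) (lval a) (constituent pd (rcons w x))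
}.

Definition Hom_SA : gmod R := homg S A.

Definition cup (m n : int) (f g : Hom_SA) : Hom_SA :=
  convolve mul_pairing m n f g.

Definition cup_one : Hom_SA :=
  linext (fun w : seq (letter V) => if w is [::] then cone else 0).

Definition D_zero (n : int) (f : Hom_SA) : Hom_SA := hom_d d0 cx_d n f.

Definition pd_star (pd : S -> S) (j : nat) (n : int) (f : Hom_SA) : Hom_SA :=
  fun x => sgn (n + 1) *: f (pd_ pd j x).

Definition pd_t (t : S -> Der A) (j : nat) (n : int) (f : Hom_SA) : Hom_SA :=
  convolve eval_pairing (-1) n (t_ t j) f.

Definition D_ (pd : S -> S) (t : S -> Der A) (j : nat) (n : int)
    (f : Hom_SA) : Hom_SA :=
  if j is 0 then D_zero n f else pd_t t j n f + pd_star pd j n f.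

Definition sym_deg (n : int) (f : S -> A) : Prop :=
  hom_deg n f /\ amultilinear cmul n f.

Lemma sym_deg0 n : sym_deg n 0.
Proof.
split=> [|u v a x]; first exact: hom_deg0.
change (0 = sgn (ldeg a * (n + wdeg u)) *: cmul (lval a) 0 :> A).
have -> : cmul (lval a) 0 = 0 :> A; last by rewrite scaler0.
by have := cmul_linr (lval a) (-1) 0 0; rewrite /= scaler0 addr0 scaleN1r addNr.
Qed.

Lemma sym_degD n a f g : sym_deg n f -> sym_deg n g -> sym_deg n (a *: f + g).
Proof.
move=> [hf mf] [hg mg]; split=> [|u v b x]; first exact: hom_degD.
set w := sprod _; set w' := sprod (u ++ x :: v).
change (a *: f w + g w =
  sgn (ldeg b * (n + wdeg u)) *: cmul (lval b) (a *: f w' + g w')).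
rewrite (cmul_linr (lval b) a) mf mg -/w' scalerDr !scalerA.
by rewrite [a * _]mulrC.
Qed.

Definition Sym : gmod R := @Gmod R (S -> A : Type) _ sym_deg0 sym_degD.

Definition Sym_filt (l : nat) (f : Sym) : Prop :=
  forall x, coaug (l%:Z - 1) x -> f x = 0.

End ShLie.

Section WellDefined.
Context {R : comNzRingType} {V : gmod R}.
Implicit Types u v w : seq (letter V).

Definition symmultilin (M : lmodType R) (f : seq (letter V) -> M) : Prop :=
  (forall u v a x y z, llin a x y z ->
     f (u ++ z :: v) = a *: f (u ++ x :: v) + f (u ++ y :: v)) /\
  (forall u v x y, f (u ++ [:: x, y & v]) =
     sgn (ldeg x * ldeg y) *: f (u ++ [:: y, x & v])).

Lemma symmultilin_kills (M : lmodType R) (f : seq (letter V) -> M) :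
  symmultilin f -> kills (@symrel R V) f.
Proof.
move=> [hl hc] s; case=> [u v a x y z h|u v x y].
  by rewrite /feval !big_cons big_nil /= (hl _ _ _ _ _ _ h) scale1r !scaleNr
    scale1r addr0 -opprD subrr.
by rewrite /feval !big_cons big_nil /= hc scale1r scaleNr addr0 subrr.
Qed.

Lemma wdeg_cat u v : wdeg (u ++ v) = wdeg u + wdeg v.
Proof. by rewrite /wdeg big_cat. Qed.

Lemma wdeg_cons x v : wdeg (x :: v) = ldeg x + wdeg v.
Proof. by rewrite /wdeg big_cons. Qed.

Lemma sgnD m n : sgn (m + n) = sgn m * sgn n :> R.
Proof.
rewrite /sgn -signr_odd -[X in X * _]signr_odd -[X in _ * X]signr_odd -signr_addb.
congr (_ ^+ nat_of_bool _); lia.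
Qed.

Definition unshuffle_sum (M : lmodType R) (F : seq (letter V) -> seq (letter V) -> M) w :=
  \sum_(p <- unshuffle w) p.1 *: F p.2.1 p.2.2.

Lemma unshuffle_sum_cons (M : lmodType R) (F : seq (letter V) -> seq (letter V) -> M) x w :
  unshuffle_sum F (x :: w) = unshuffle_sum (fun u v => F (x :: u) v) w
    + unshuffle_sum (fun u v => sgn (ldeg x * wdeg u) *: F u (x :: v)) w.
Proof.
rewrite /unshuffle_sum /= big_cat !big_map; congr (_ + _).
by apply: eq_bigr => p _ /=; rewrite scalerA.
Qed.

Lemma unshuffle_sumD (M : lmodType R) a (F G H : seq (letter V) -> seq (letter V) -> M) w :
  (forall u v, F u v = a *: G u v + H u v) -> unshuffle_sum F w = a *: unshuffle_sum G w + unshuffle_sum H w.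
Proof.
move=> h; rewrite /unshuffle_sum scaler_sumr -big_split; apply: eq_bigr => p _.
by rewrite h scalerDr !scalerA mulrC.
Qed.

Definition bisymmultilin (M : lmodType R) (F : seq (letter V) -> seq (letter V) -> M) :=
  (forall v, symmultilin (fun u => F u v)) /\ (forall u, symmultilin (F u)).

Lemma wdeg_lin u v a x y z : llin a x y z ->
  wdeg (u ++ z :: v) = wdeg (u ++ x :: v) /\ wdeg (u ++ y :: v) = wdeg (u ++ x :: v).
Proof. by case=> h1 h2 _; rewrite !wdeg_cat !wdeg_cons h1 h2. Qed.

Lemma bisymmultilin_l (M : lmodType R) (F : seq (letter V) -> seq (letter V) -> M) t :
  bisymmultilin F -> bisymmultilin (fun u v => F (t :: u) v).
Proof.
move=> [h1 h2]; split=> [v|u]; last exact: h2.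
by have [hl hc] := h1 v; split=> [u|u] *; [exact: (hl (t :: u))|exact: (hc (t::u))].
Qed.

Lemma bisymmultilin_r (M : lmodType R) (F : seq (letter V) -> seq (letter V) -> M) t :
  bisymmultilin F -> bisymmultilin (fun u v => sgn (ldeg t * wdeg u) *: F u (t :: v)).
Proof.
move=> [h1 h2]; split=> [v|u].
  have [hl hc] := h1 (t :: v); split=> [u w a x y z h|u w x y].
    have [-> ->] := wdeg_lin u w h.
    by rewrite (hl _ _ _ _ _ _ h) scalerDr !scalerA mulrC.
  rewrite hc !scalerA mulrC; congr (_ * sgn (_ * _) *: _).
  by rewrite !wdeg_cat !wdeg_cons; congr (_ + _); rewrite addrCA.
have [hl hc] := h2 u; split=> [v w a x y z h|v w x y].
  by rewrite (hl (t :: v) _ _ _ _ _ h) scalerDr !scalerA mulrC.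
by rewrite (hc (t :: v)) !scalerA mulrC.
Qed.

Lemma sgn2 n : sgn n * sgn n = 1 :> R.
Proof. by rewrite -sgnD /sgn -signr_odd; have -> : odd `|n + n| = false by lia. Qed.

Lemma unshuffle_sum_symmultilin (M : lmodType R) (F : seq (letter V) -> seq (letter V) -> M) :
  bisymmultilin F -> symmultilin (unshuffle_sum F).
Proof.
move=> gF; split=> [u v a x y z h|u v x y].
  elim: u F gF => [|t u IH] F gF /=.
    have [d1 d2 _] := h; rewrite !unshuffle_sum_cons.
    rewrite [X in X + _](@unshuffle_sumD _ a _ (fun u v => F (x :: u) v) (fun u v => F (y :: u) v)).
    rewrite [X in _ + X](@unshuffle_sumD _ a _ (fun u v => sgn (ldeg x * wdeg u) *: F u (x :: v))
      (fun u v => sgn (ldeg y * wdeg u) *: F u (y :: v))).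
    - by rewrite scalerDr addrACA.
    - move=> p q; have [hl _] := gF.2 p.
      by rewrite (hl [::] _ _ _ _ _ h) d1 d2 scalerDr !scalerA mulrC.
    - move=> p q; have [hl _] := gF.1 q; exact: (hl [::] _ _ _ _ _ h).
  rewrite !unshuffle_sum_cons (IH _ (bisymmultilin_l t gF)) (IH _ (bisymmultilin_r t gF)) scalerDr.
  by rewrite addrACA.
elim: u F gF => [|t u IH] F gF /=; last first.
  by rewrite !unshuffle_sum_cons (IH _ (bisymmultilin_l t gF)) (IH _ (bisymmultilin_r t gF)) scalerDr.
have Z (G H : seq (letter V) -> seq (letter V) -> M) c w :
    (forall u v, G u v = c *: H u v) -> unshuffle_sum G w = c *: unshuffle_sum H w.
  move=> e; rewrite /unshuffle_sum scaler_sumr; apply: eq_bigr => p _.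
  by rewrite e !scalerA mulrC.
rewrite !unshuffle_sum_cons !scalerDr -!addrA; congr (_ + _).
  by apply: Z => p q; have [_ hc] := gF.1 q; exact: (hc [::]).
rewrite [RHS]addrCA; congr (_ + _); last congr (_ + _).
- apply: Z => p q; rewrite wdeg_cons mulrDr sgnD scalerA mulrA.
  by rewrite [ldeg y * ldeg x]mulrC sgn2 mul1r.
- by apply: Z => p q; rewrite wdeg_cons mulrDr sgnD scalerA.
- apply: Z => p q; have [_ hc] := gF.2 p.
  rewrite (hc [::]) !scalerA; congr (_ *: _); ring.
Qed.

Lemma sprod_symmultilin : symmultilin (@sprod R V).
Proof.
split=> [u v a x y z h|u v x y].
  have := gen_kills (symrel_lin u v h).
  rewrite /feval !big_cons big_nil /= scale1r addr0 scaleN1r scaleNr -opprD.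
  by move/eqP; rewrite subr_eq0 => /eqP.
have := gen_kills (symrel_comm u v x y).
rewrite /feval !big_cons big_nil /= scale1r addr0 scaleNr.
by move/eqP; rewrite subr_eq0 => /eqP.
Qed.

Lemma sprod_deg w : gpc (symg V) (wdeg w) (sprod w).
Proof.
exists [:: (1, w)]; split; first by move=> p; rewrite inE => /eqP ->.
by rewrite big_seq1 scale1r.
Qed.

Lemma tens_l (M N : gmod R) a (x x' z : letter M) (y : letter N) :
  llin a x x' z -> tens z y = a *: tens x y + tens x' y.
Proof.
move=> h; have := gen_kills (tensrel_l y h).
rewrite /feval !big_cons big_nil /= scale1r addr0 scaleN1r scaleNr -opprD.
by move/eqP; rewrite subr_eq0 => /eqP.
Qed.

Lemma tens_r (M N : gmod R) a (x x' z : letter N) (y : letter M) :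
  llin a x x' z -> tens y z = a *: tens y x + tens y x'.
Proof.
move=> h; have := gen_kills (tensrel_r y h).
rewrite /feval !big_cons big_nil /= scale1r addr0 scaleN1r scaleNr -opprD.
by move/eqP; rewrite subr_eq0 => /eqP.
Qed.

Lemma sletter_lin u v a x y z : llin a x y z ->
  llin a (sletter (u ++ x :: v)) (sletter (u ++ y :: v)) (sletter (u ++ z :: v)).
Proof.
move=> h; have [e1 e2] := wdeg_lin u v h.
split; rewrite /sletter;
 rewrite ?(lettE (sprod_deg _)).1 ?(lettE (sprod_deg _)).2 //.
exact: sprod_symmultilin.1.
Qed.

Lemma sletter_comm u v x y :
  llin (sgn (ldeg x * ldeg y)) (sletter (u ++ [:: y, x & v])) 
  (letter0 (wdeg (u ++ [:: y, x & v]))) (sletter (u ++ [:: x, y & v])).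
Proof.
split; rewrite /sletter ?(lettE (sprod_deg _)).1 ?(lettE (sprod_deg _)).2 //.
- by rewrite !wdeg_cat !wdeg_cons; congr (_ + _); rewrite addrCA.
- by rewrite /lval /= addr0 sprod_symmultilin.2.
Qed.

Lemma tens0l (M N : gmod R) n (y : letter N) : tens (@letter0 R M n) y = 0.
Proof.
have := @tens_l M N (-1) (letter0 n) (letter0 n) (letter0 n) y.
by rewrite scaleN1r addNr; apply; split=> //; rewrite /lval /= scaler0 addr0.
Qed.

Lemma tens0r (M N : gmod R) n (y : letter N) : tens y (@letter0 R M n) = 0.
Proof.
have := @tens_r N M (-1) (letter0 n) (letter0 n) (letter0 n) y.
by rewrite scaleN1r addNr; apply; split=> //; rewrite /lval /= scaler0 addr0.
Qed.

Lemma diag_sprod w :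
  diag (sprod w) = \sum_(p <- unshuffle w)
    p.1 *: tens (sletter p.2.1) (sletter p.2.2).
Proof.
rewrite /diag linextE //; apply: symmultilin_kills; apply: (@unshuffle_sum_symmultilin _
  (fun u v => tens (sletter u) (sletter v))).
split=> q; split=> *.
- by apply: tens_l; apply: sletter_lin.
- by rewrite (tens_l _ (sletter_comm _ _ _ _)) tens0l addr0.
- by apply: tens_r; apply: sletter_lin.
- by rewrite (tens_r _ (sletter_comm _ _ _ _)) tens0r addr0.
Qed.

Lemma coder_sprod k c w : symmultilin c -> (forall w, gpc V (wdeg w - 1) (c w)) ->
  coder k c (sprod w) =  \sum_(p <- unshuffle w | size p.2.1 == k)
    p.1 *: sprod (lett (wdeg p.2.1 - 1) (c p.2.1) :: p.2.2).
Proof.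
move=> hc dc; rewrite /coder linextE //; apply: symmultilin_kills.
have E w' : \sum_(p <- unshuffle w' | size p.2.1 == k)
    p.1 *: sprod (lett (wdeg p.2.1 - 1) (c p.2.1) :: p.2.2) =
   unshuffle_sum (fun u v => if size u == k then sprod (lett (wdeg u - 1) (c u) :: v) else 0) w'.
  rewrite big_mkcond; apply: eq_bigr => p _; by case: ifP; rewrite ?scaler0.
suff [K1 K2] : symmultilin (unshuffle_sum (fun u v => if size u == k then sprod (lett (wdeg u - 1) (c u) :: v) else 0)).
  by split=> *; rewrite !E; [exact: K1|exact: K2].
apply: unshuffle_sum_symmultilin; split=> q; split=> [u v a x y z h|u v x y].
- rewrite !size_cat /=; case: ifP => _; last by rewrite scaler0 addr0.
  have [e1 e2] := wdeg_lin u v h.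
  apply: (sprod_symmultilin.1 [::]); rewrite e1 e2.
  have d z' : wdeg (u++z'::v) = wdeg (u ++ x :: v) -> gpc V (wdeg (u ++ x :: v) - 1) (c (u ++ z' :: v)) by move=> <-.
  by split; rewrite ?(lettE (d _ _)).1 ?(lettE (d _ _)).2 // (hc.1 _ _ _ _ _ _ h).
- rewrite !size_cat /=; case: ifP => _; last by rewrite scaler0.
  have e : wdeg (u ++ [:: x, y & v]) = wdeg (u ++ [:: y, x & v]).
    by rewrite !wdeg_cat !wdeg_cons; congr (_ + _); rewrite addrCA.
  have d := dc (u ++ [:: x, y & v]); have d' := dc (u ++ [:: y, x & v]). rewrite e in d.
  rewrite e.
  have L : llin (sgn (ldeg x * ldeg y)) (lett (wdeg (u ++ [:: y, x & v]) - 1) (c (u ++ [:: y, x & v])))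
    (letter0 (wdeg (u ++ [:: y, x & v]) - 1)) (lett (wdeg (u ++ [:: y, x & v]) - 1) (c (u ++ [:: x, y & v]))).
    split; rewrite ?(lettE d).1 ?(lettE d).2 ?(lettE d').1 ?(lettE d').2 //.
    by rewrite /lval /= addr0 hc.2.
  rewrite (sprod_symmultilin.1 [::] _ _ _ _ _ L).
  have -> : sprod (letter0 (M := V) (wdeg (u ++ [:: y, x & v]) - 1) :: q) = 0; last by rewrite addr0.
  have := sprod_symmultilin.1 [::] q (-1) (letter0 (wdeg (u ++ [:: y, x & v]) - 1)) (letter0 (wdeg (u ++ [:: y, x & v]) - 1)) (letter0 (wdeg (u ++ [:: y, x & v]) - 1)).
  by rewrite scaleN1r addNr; apply; split=> //; rewrite /lval /= scaler0 addr0.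
- by case: ifP => _; [apply: (sprod_symmultilin.1 (_ :: u))|rewrite scaler0 addr0].
- by case: ifP => _; [apply: (sprod_symmultilin.2 (_ :: u))|rewrite scaler0].
Qed.
End WellDefined.

(* Main.v *)
Require Import Defs.
From HB Require Import structures.
From mathcomp Require Import all_boot all_order all_algebra.
From mathcomp Require Import boolp classical_sets functions.
From mathcomp Require Import zify ring.

Set Implicit Arguments.
Unset Strict Implicit.
Unset Printing Implicit Defensive.

Import GRing.Theory.
Local Open Scope ring_scope.

(* A form f on S[sL] is determined by its values on words, and on words all the
   operations are signed sums over unshuffles; identities between them reduce
   to coassociativity and cocommutativity of the unshuffles and to a parity
   count.  Every D_j, D_0 included, and their sum D are instances of

     (D f)(w) = sum +- tau(u)(f v) +- f(c(u) v)   over the unshuffles (u, v) of w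

   for derivation-valued tau and a constituent c.  Such an operator is a
   derivation of the cup product; it preserves A-multilinear forms when
   c(u, a x) = tau(u)(a) x +- a c(u, x), because the two terms in which a is
   differentiated cancel; and it squares to zero when the coderivation of c
   does and tau is twisting.  For D this requires the sum of the pd^j to be pd,
   i.e. that a coderivation is determined by its constituents, which uses that
   R contains Q.

   If D_j lowers the filtration by j + 1, testing it on constants gives
   t_j = 0, and then on linear forms f(v, -) gives f(v, pd^j(u)) = 0, whence
   D_j = 0. *)

(** * Linear maps and signs *)

(** The compatibility of t_j with pd^j concerns constituents and the last letter of a word, while a
    coderivation acts on all of S[sL]; everything is therefore carried to words once, where signs
    depend only on the parities of the subwords. Rational coefficients enter twice: the operator
    that multiplies a word by its length must be injective in positive lengths for a coderivation to
    be recovered from its constituents, and the factor 1/2 in t /\ t must cancel against a doubled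
    sum. The sum of the D_j may be infinite on a given form, but a word of length k meets only D_0,
    ..., D_k; so the total operator is defined word by word and converges for the filtration, which
    is complete because a form amounts to the sequence of its restrictions to the S^k[sL].
    Strictness cannot be reduced to the vanishing of pd^j, since sL may have too few A-linear forms
    to detect it; the test forms are instead cut out of f itself. *)

Section LinearProp.
Context {R : comNzRingType} {U W : lmodType R} (f : U -> W).
Hypothesis lf : linear f.

Lemma linear_fun0 : f 0 = 0.
Proof. by have := lf (-1) 0 0; rewrite scaler0 addr0 scaleN1r addNr. Qed.

Lemma linear_funD x y : f (x + y) = f x + f y.
Proof. by have := lf 1 x y; rewrite !scale1r. Qed.

Lemma linear_funZ a x : f (a *: x) = a *: f x.
Proof. by have := lf a x 0; rewrite linear_fun0 !addr0. Qed.

Lemma linear_funB x y : f (x - y) = f x - f y.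
Proof. by rewrite -[- y]scaleN1r linear_funD linear_funZ scaleN1r. Qed.

Lemma linear_fun_sum (I : Type) (r : seq I) (P : pred I) (F : I -> U) :
  f (\sum_(i <- r | P i) F i) = \sum_(i <- r | P i) f (F i).
Proof. exact: (big_morph f linear_funD linear_fun0). Qed.

End LinearProp.

Section Presented.
Context {R : comNzRingType} {X : choiceType} {rel : seq (R * X) -> Prop}.
Local Notation P := (presented rel).

Lemma presented_sum (x : P) : exists s : seq (R * X), x = \sum_(p <- s) p.1 *: gen rel p.2.
Proof.
elim/pclassW: x => s; exists s.
elim: s => [|[a x] s IH]; first by rewrite big_nil.
rewrite big_cons -IH [_ *: _]pscaleE [RHS]paddE.
by apply/pclassP => M f k; rewrite /feval !big_cons mulr1.
Qed.

Lemma eq_linear_gen (M : lmodType R) (f g : P -> M) :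
  linear f -> linear g -> (forall x, f (gen rel x) = g (gen rel x)) -> f =1 g.
Proof.
move=> lf lg e x; have [s ->] := presented_sum x.
rewrite !linear_fun_sum //; apply: eq_bigr => p _.
by rewrite !linear_funZ // e.
Qed.

End Presented.

Section Sign.
Context {R : comNzRingType}.

Definition par (n : int) : bool := odd `|n|%N.

Lemma parD m n : par (m + n) = par m (+) par n.
Proof. rewrite /par; lia. Qed.

Lemma parM m n : par (m * n) = par m && par n.
Proof. by rewrite /par abszM oddM. Qed.

Lemma parN n : par (- n) = par n.
Proof. by rewrite /par abszN. Qed.

Lemma par1 : par 1 = true. Proof. by []. Qed.
Lemma par0 : par 0 = false. Proof. by []. Qed.

Lemma sgn_par m n : par m = par n -> sgn m = sgn n :> R.
Proof. by rewrite /par /sgn => e; rewrite -signr_odd e signr_odd. Qed.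

Lemma sgn_opp m n : par m = ~~ par n -> sgn m = - sgn n :> R.
Proof.
rewrite /par /sgn => e; rewrite -(signr_odd _ `|m|) e -(signr_odd _ `|n|).
by case: odd; rewrite ?opprK.
Qed.

Lemma sgn0 : sgn 0 = 1 :> R.
Proof. by rewrite /sgn. Qed.

Lemma scaler_sgnK (M : lmodType R) n (x : M) : sgn n *: (sgn n *: x) = x.
Proof. by rewrite scalerA sgn2 scale1r. Qed.

End Sign.

(* Two products of signs are compared through the parities of the exponents,
   the parities of the atoms being arbitrary booleans. *)
Ltac par_solve :=
  rewrite ?(parD, parM, parN, par1, par0);
  repeat match goal with |- context [par ?x] => case: (par x) end; done.
Ltac sgn_solve := rewrite -?sgnD; apply: sgn_par; par_solve.

(** * Sums over unshuffles *)

Section Words.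
Context {R : comNzRingType} {V : gmod R}.
Implicit Types (u v w : seq (letter V)) (x y : letter V).

Lemma wdeg_nil : wdeg ([::] : seq (letter V)) = 0.
Proof. by rewrite /wdeg big_nil. Qed.

Lemma wdeg_rcons w x : wdeg (rcons w x) = wdeg w + ldeg x.
Proof. by rewrite -cats1 wdeg_cat wdeg_cons wdeg_nil addr0. Qed.

Lemma wdeg_seq1 x : wdeg [:: x] = ldeg x.
Proof. by rewrite wdeg_cons wdeg_nil addr0. Qed.

Section Sums.
Context {M : lmodType R}.
Implicit Types F G : seq (letter V) -> seq (letter V) -> M.

Lemma unshuffle_inv w p : p \in unshuffle w ->
  wdeg p.2.1 + wdeg p.2.2 = wdeg w /\ (size p.2.1 + size p.2.2)%N = size w.
Proof.
elim: w p => [|x w IH] p /=; first by rewrite inE => /eqP -> /=; rewrite wdeg_nil.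
rewrite mem_cat => /orP[] /mapP[q /IH[h1 h2] ->] /=; rewrite -h2 !wdeg_cons -h1.
  by rewrite addrA.
by rewrite addrCA addnS.
Qed.

Lemma eq_usum F G w :
  (forall u v, wdeg w = wdeg u + wdeg v -> size w = (size u + size v)%N ->
     F u v = G u v) ->
  unshuffle_sum F w = unshuffle_sum G w.
Proof.
move=> e; rewrite /unshuffle_sum !big_seq; apply: eq_bigr => p /unshuffle_inv[h1 h2].
by rewrite e.
Qed.

Lemma usum_nil F : unshuffle_sum F [::] = F [::] [::].
Proof. by rewrite /unshuffle_sum /= big_seq1 scale1r. Qed.

Lemma usum0 w : unshuffle_sum (fun _ _ => 0 : M) w = 0.
Proof. by rewrite /unshuffle_sum big1 // => p _; rewrite scaler0. Qed.

Lemma usum_eq0 F w :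
  (forall u v, wdeg w = wdeg u + wdeg v -> size w = (size u + size v)%N ->
     F u v = 0) -> unshuffle_sum F w = 0.
Proof. by move=> h; rewrite (eq_usum (G := fun _ _ => 0)) ?usum0. Qed.

Lemma usumD F G w :
  unshuffle_sum (fun u v => F u v + G u v) w = unshuffle_sum F w + unshuffle_sum G w.
Proof.
rewrite /unshuffle_sum -big_split; apply: eq_bigr => p _; exact: scalerDr.
Qed.

Lemma usumZ a F w :
  unshuffle_sum (fun u v => a *: F u v) w = a *: unshuffle_sum F w.
Proof.
rewrite /unshuffle_sum scaler_sumr; apply: eq_bigr => p _.
by rewrite !scalerA mulrC.
Qed.

Lemma usum_linear (N : lmodType R) (f : M -> N) F w : linear f ->
  f (unshuffle_sum F w) = unshuffle_sum (fun u v => f (F u v)) w.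
Proof.
move=> lf; rewrite /unshuffle_sum linear_fun_sum //; apply: eq_bigr => p _.
exact: linear_funZ.
Qed.

Lemma usum_unitl F w : (forall u v, u != [::] -> F u v = 0) ->
  unshuffle_sum F w = F [::] w.
Proof.
elim: w F => [|x w IH] F h; first by rewrite usum_nil.
rewrite unshuffle_sum_cons usum_eq0 => [|u v _ _]; last by rewrite h.
rewrite add0r IH => [|u v hu]; last by rewrite h ?scaler0.
by rewrite wdeg_nil mulr0 sgn0 scale1r.
Qed.

Lemma usum_unitr F w : (forall u v, v != [::] -> F u v = 0) ->
  unshuffle_sum F w = F w [::].
Proof.
elim: w F => [|x w IH] F h; first by rewrite usum_nil.
rewrite unshuffle_sum_cons addrC usum_eq0 => [|u v _ _]; last by rewrite h ?scaler0.
by rewrite add0r IH // => u v hu; rewrite h.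
Qed.

(** [unshuffle] peels off the first letter, whereas the Leibniz rule of an sh Lie-Rinehart algebra
    puts the factor from A on the last one. Appending x to the left subword carries it past v, hence
    the sign. *)
Lemma usum_rcons F w x :
  unshuffle_sum F (rcons w x) = unshuffle_sum (fun u v => F u (rcons v x)) w
    + unshuffle_sum (fun u v => sgn (ldeg x * wdeg v) *: F (rcons u x) v) w.
Proof.
elim: w F => [|y w IH] F.
  rewrite /= unshuffle_sum_cons !usum_nil /= !wdeg_nil !mulr0 sgn0 !scale1r.
  exact: addrC.
rewrite /= !unshuffle_sum_cons !IH -!addrA; congr (_ + _).
rewrite addrCA; congr (_ + (_ + _)).
apply: eq_usum => u v _ _; rewrite wdeg_rcons wdeg_cons !scalerA /=.
congr (_ *: _); sgn_solve.
Qed.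

Lemma usum_cocomm F w :
  unshuffle_sum F w = unshuffle_sum (fun u v => sgn (wdeg u * wdeg v) *: F v u) w.
Proof.
elim: w F => [|x w IH] F.
  by rewrite !usum_nil wdeg_nil mul0r sgn0 scale1r.
rewrite !unshuffle_sum_cons addrC; congr (_ + _); rewrite IH; apply: eq_usum => u v _ _.
  by rewrite wdeg_cons scalerA; congr (_ *: _); sgn_solve.
by rewrite wdeg_cons scalerA; congr (_ *: _); sgn_solve.
Qed.

Definition usum3 (F : seq (letter V) -> seq (letter V) -> seq (letter V) -> M) w :=
  unshuffle_sum (fun u => unshuffle_sum (F u)) w.

(** Both sides run over the ordered splittings of w into three blocks; the induction decides which
    block takes the first letter. *)
Lemma usum_coassoc (F : seq (letter V) -> seq (letter V) -> seq (letter V) -> M) w :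
  unshuffle_sum (fun u z => unshuffle_sum (fun u v => F u v z) u) w = usum3 F w.
Proof.
rewrite /usum3; elim: w F => [|x w IH] F; first by rewrite !usum_nil.
rewrite !unshuffle_sum_cons.
under eq_usum => u z _ _ do rewrite unshuffle_sum_cons.
rewrite usumD !IH -addrA; congr (_ + _).
transitivity (unshuffle_sum (fun u v => 
    unshuffle_sum (fun v z => sgn (ldeg x * wdeg u) *: F u (x :: v) z) v
    + unshuffle_sum (fun v z => sgn (ldeg x * (wdeg u + wdeg v)) *: F u v (x :: z)) v) w).
  rewrite usumD; congr (_ + _).
  rewrite -(IH (fun u v z => sgn (ldeg x * (wdeg u + wdeg v)) *: F u v (x :: z))).
  apply: eq_usum => u v _ _.
  by rewrite -usumZ; apply: eq_usum => u1 u2 -> _.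
apply: eq_usum => u v _ _; rewrite unshuffle_sum_cons scalerDr -!usumZ.
congr (_ + _); apply: eq_usum => p q _ _.
by rewrite scalerA; congr (_ *: _); sgn_solve.
Qed.

Lemma usum3_swap (F : seq (letter V) -> seq (letter V) -> seq (letter V) -> M) w :
  usum3 F w = usum3 (fun u v z => sgn (wdeg u * wdeg v) *: F v u z) w.
Proof.
rewrite -!usum_coassoc; apply: eq_usum => u z _ _; exact: usum_cocomm.
Qed.

Lemma usum3D (F G : seq (letter V) -> seq (letter V) -> seq (letter V) -> M) w :
  usum3 (fun u v z => F u v z + G u v z) w = usum3 F w + usum3 G w.
Proof. by rewrite /usum3 -usumD; apply: eq_usum => u v _ _; rewrite usumD. Qed.

End Sums.
End Words.
(** * Linear maps on tensors and on symmetric words *)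

Section GradedMaps.
Context {R : comNzRingType}.

Lemma gpcZ (M : gmod R) n a x : gpc M n x -> gpc M n (a *: x).
Proof. by move=> hx; rewrite -[a *: x]addr0; apply: gpcD => //; exact: gpc0. Qed.

Lemma gpcDr (M : gmod R) n x y : gpc M n x -> gpc M n y -> gpc M n (x + y).
Proof. by move=> hx hy; rewrite -[x]scale1r; apply: gpcD. Qed.

Lemma gpc_sum (M : gmod R) n (I : eqType) (r : seq I) (F : I -> M) :
  (forall i, i \in r -> gpc M n (F i)) -> gpc M n (\sum_(i <- r) F i).
Proof.
move=> h; rewrite big_seq; apply: (big_ind (gpc M n)); [exact: gpc0|exact: gpcDr|exact: h].
Qed.

Lemma gpc_usum (M V : gmod R) n (F : seq (letter V) -> seq (letter V) -> M) w :
  (forall u v, wdeg w = wdeg u + wdeg v -> gpc M n (F u v)) ->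
  gpc M n (unshuffle_sum F w).
Proof.
move=> h; apply: gpc_sum => p /unshuffle_inv[e _].
by apply: gpcZ; apply: h.
Qed.

Definition letter_bilinear (M N : gmod R) (P : lmodType R)
    (b : letter M -> letter N -> P) : Prop :=
  (forall a x x' z y, llin a x x' z -> b z y = a *: b x y + b x' y) /\
  (forall a x y y' z, llin a y y' z -> b x z = a *: b x y + b x y').

Lemma letter_bilinear_kills (M N : gmod R) (P : lmodType R)
    (b : letter M -> letter N -> P) :
  letter_bilinear b -> kills (@tensrel R M N) (fun p => b p.1 p.2).
Proof.
move=> [hl hr] s; case=> [a x x' z y|a x y y' z] h;
  rewrite /feval !big_cons big_nil /= ?(hl _ _ _ _ _ h) ?(hr _ _ _ _ _ h);
  by rewrite scale1r !scaleNr scale1r addr0 -opprD subrr.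
Qed.

Lemma tlift_linear (M N : gmod R) (P : lmodType R)
    (b : letter M -> letter N -> P) : letter_bilinear b -> linear (tlift b).
Proof. by move=> hb; apply: linext_linear; exact: letter_bilinear_kills. Qed.

Lemma tlift_tens (M N : gmod R) (P : lmodType R)
    (b : letter M -> letter N -> P) x y :
  letter_bilinear b -> tlift b (tens x y) = b x y.
Proof. by move=> hb; rewrite /tlift linextE //; exact: letter_bilinear_kills. Qed.

Lemma llin_hom (M N : gmod R) m (f : M -> N) a (x x' z : letter M) :
  hom_deg m f -> llin a x x' z ->
  llin a (lett (ldeg x + m) (f (lval x))) (lett (ldeg x' + m) (f (lval x')))
    (lett (ldeg z + m) (f (lval z))).
Proof.
move=> [lf df] [e e' ez]; have d (y : letter M) := df _ _ (lval_gpc y).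
by split; rewrite ?(lettE (d _)).1 ?(lettE (d _)).2 ?e ?e' // ez lf.
Qed.

Section Tmap.
Context (M N M' N' : gmod R) (m n : int) (f : M -> M') (g : N -> N').
Hypotheses (hf : hom_deg m f) (hg : hom_deg n g).

Lemma tmap_bilinear : letter_bilinear (fun x y => sgn (n * ldeg x) *:
    tens (lett (ldeg x + m) (f (lval x))) (lett (ldeg y + n) (g (lval y)))).
Proof.
split=> [a x x' z y h|a x y y' z h].
  rewrite (tens_l _ (llin_hom hf h)); have [-> -> _] := h.
  by rewrite scalerDr !scalerA mulrC.
by rewrite (tens_r _ (llin_hom hg h)) scalerDr !scalerA mulrC.
Qed.

Lemma tmap_linear : linear (tmap m n f g).
Proof. exact: tlift_linear tmap_bilinear. Qed.

Lemma tmap_tens x y : tmap m n f g (tens x y) = sgn (n * ldeg x) *: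
    tens (lett (ldeg x + m) (f (lval x))) (lett (ldeg y + n) (g (lval y))).
Proof. exact: tlift_tens tmap_bilinear. Qed.

End Tmap.

Section SymmetricWords.
Context {V : gmod R}.
Local Notation S := (symg V).
Implicit Types (u v w : seq (letter V)) (x y : letter V).

Lemma diag_linear : linear (@diag R V).
Proof.
apply: linext_linear; apply: symmultilin_kills.
apply: (@unshuffle_sum_symmultilin _ _ _ (fun u v => tens (sletter u) (sletter v))).
split=> q; split=> *.
- by apply: tens_l; apply: sletter_lin.
- by rewrite (tens_l _ (sletter_comm _ _ _ _)) tens0l addr0.
- by apply: tens_r; apply: sletter_lin.
- by rewrite (tens_r _ (sletter_comm _ _ _ _)) tens0r addr0.
Qed.

Lemma ldeg_sletter w : ldeg (sletter w) = wdeg w.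
Proof. by rewrite /sletter (lettE (sprod_deg w)).1. Qed.

Lemma lval_sletter w : lval (sletter w) = sprod w.
Proof. by rewrite /sletter (lettE (sprod_deg w)).2. Qed.

Lemma tlift_diag (P : lmodType R) (b : letter S -> letter S -> P) w :
  letter_bilinear b ->
  tlift b (diag (sprod w)) = unshuffle_sum (fun u v => b (sletter u) (sletter v)) w.
Proof.
move=> hb; rewrite diag_sprod linear_fun_sum; last exact: tlift_linear.
apply: eq_bigr => p _; rewrite linear_funZ; last exact: tlift_linear.
by rewrite tlift_tens.
Qed.

Lemma tlift_tmap_diag (M N : gmod R) (P : lmodType R) (b : letter M -> letter N -> P)
    m n (f : S -> M) (g : S -> N) w :
  letter_bilinear b -> hom_deg m f -> hom_deg n g ->
  tlift b (tmap m n f g (diag (sprod w))) =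
    unshuffle_sum (fun u v => sgn (n * wdeg u) *:
      b (lett (wdeg u + m) (f (sprod u))) (lett (wdeg v + n) (g (sprod v)))) w.
Proof.
move=> hb hf hg; have lt := tmap_linear hf hg; have lb := tlift_linear hb.
rewrite diag_sprod (linear_fun_sum lt) (linear_fun_sum lb).
apply: eq_bigr => p _.
rewrite (linear_funZ lt) (linear_funZ lb) tmap_tens // (linear_funZ lb) tlift_tens //.
by rewrite !ldeg_sletter !lval_sletter.
Qed.

Lemma linext_sprod (P : lmodType R) (F : seq (letter V) -> P) w :
  symmultilin F -> linext F (sprod w : symg V) = F w.
Proof. by move=> hF; rewrite linextE //; exact: symmultilin_kills. Qed.

Lemma linext_sym_linear (P : lmodType R) (F : seq (letter V) -> P) :
  symmultilin F -> linear (linext F : S -> P).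
Proof. by move=> hF; apply: linext_linear; exact: symmultilin_kills. Qed.

Lemma eq_linear_sprod (P : lmodType R) (f g : S -> P) :
  linear f -> linear g -> (forall w, f (sprod w) = g (sprod w)) -> f =1 g.
Proof. by move=> lf lg e; apply: eq_linear_gen. Qed.

Lemma linear_symmultilin (P : lmodType R) (f : S -> P) :
  linear f -> symmultilin (fun w => f (sprod w)).
Proof.
move=> lf; split=> [u v a x y z h|u v x y].
  by rewrite (sprod_symmultilin.1 _ _ _ _ _ _ h) lf.
by rewrite sprod_symmultilin.2 linear_funZ.
Qed.

Lemma hom_deg_sprod (M : gmod R) n (f : S -> M) :
  linear f -> (forall w, gpc M (wdeg w + n) (f (sprod w))) -> hom_deg n f.
Proof.
move=> lf df; split=> // i _ [s [hs ->]]; rewrite linear_fun_sum //.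
apply: gpc_sum => p ps; rewrite linear_funZ //; apply: gpcZ.
by rewrite -(hs p ps); exact: df.
Qed.

Lemma hom_deg_gpc (M : gmod R) n (f : S -> M) w :
  hom_deg n f -> gpc M (wdeg w + n) (f (sprod w)).
Proof. by move=> [_ df]; apply: df; exact: sprod_deg. Qed.

Lemma symmultilin_mask (P : lmodType R) (q : pred nat) (F : seq (letter V) -> P) :
  symmultilin F -> symmultilin (fun w => if q (size w) then F w else 0).
Proof.
move=> [hl hc]; split=> [u v a x y z h|u v x y]; rewrite !size_cat /=.
  by case: ifP => _; [exact: hl|rewrite scaler0 addr0].
by case: ifP => _; [exact: hc|rewrite scaler0].
Qed.

Lemma wproj_symmultilin k :
  symmultilin (fun w => if size w == k then sprod w : S else 0).
Proof. exact: (symmultilin_mask (fun i => i == k) sprod_symmultilin). Qed.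

Lemma wproj_sprod k w : wproj k (sprod w) = if size w == k then sprod w else 0 :> S.
Proof. exact: linext_sprod (wproj_symmultilin k). Qed.

Lemma wproj_linear k : linear (wproj k : S -> S).
Proof. exact: linext_sym_linear (wproj_symmultilin k). Qed.

Lemma corest_symmultilin :
  symmultilin (fun w : seq (letter V) => if w is [:: x] then lval x else 0).
Proof.
split=> [[|t [|t' u]] [|s v] a x y z|[|t [|t' u]] v x y] /=;
  by rewrite ?scaler0 ?addr0 //; case.
Qed.

Lemma corest_sprod w : corest (sprod w) = if w is [:: x] then lval x else 0 :> V.
Proof. exact: linext_sprod corest_symmultilin. Qed.

Lemma corest_hom : hom_deg 0 (@corest R V).
Proof.
apply: hom_deg_sprod; first exact: linext_sym_linear corest_symmultilin.
move=> [|x [|y w]]; rewrite corest_sprod; try exact: gpc0.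
by rewrite wdeg_seq1 addr0; exact: lval_gpc.
Qed.

Lemma id_hom (M : gmod R) : hom_deg 0 (fun x : M => x).
Proof. by split=> // i x; rewrite addr0. Qed.

Definition lmul x : S -> S := linext (fun w => sprod (x :: w)).

Lemma lmul_symmultilin x : symmultilin (fun w => sprod (x :: w)).
Proof.
have [hl hc] := @sprod_symmultilin R V.
by split=> [u v a x' y z h|u v x' y]; [exact: (hl (x :: u))|exact: (hc (x :: u))].
Qed.

Lemma lmul_sprod x w : lmul x (sprod w) = sprod (x :: w).
Proof. exact: linext_sprod (lmul_symmultilin x). Qed.

Lemma lmul_linear x : linear (lmul x).
Proof. exact: linext_sym_linear (lmul_symmultilin x). Qed.

Lemma lmul_llin a x x' z : llin a x x' z ->
  forall y : S, lmul z y = a *: lmul x y + lmul x' y.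
Proof.
move=> h; apply: eq_linear_gen => [||w]; first exact: lmul_linear.
  move=> c y y'; rewrite !lmul_linear scalerDr !scalerA scalerDr scalerA.
  by rewrite [a * c]mulrC -!addrA; congr (_ + _); rewrite addrCA.
by rewrite -/(sprod w) !lmul_sprod; exact: (sprod_symmultilin.1 [::]).
Qed.

(** Words consist of homogeneous letters with a recorded degree, so additivity in an element of V
    makes sense only within one degree, where [lett] returns the element itself. *)
Lemma symmultilin_linear_hd (P : lmodType R) (F : seq (letter V) -> P) v n a (y z : V) :
  symmultilin F -> gpc V n y -> gpc V n z ->
  F (lett n (a *: y + z) :: v) = a *: F (lett n y :: v) + F (lett n z :: v).
Proof.
move=> [hl _] hy hz; apply: (hl [::]).
have hyz := gpcD a hy hz.
by split; rewrite ?(lettE hy).1 ?(lettE hz).1 ?(lettE hyz).1 // ?(lettE hy).2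
  ?(lettE hz).2 ?(lettE hyz).2.
Qed.

Lemma symmultilin_hd0 (P : lmodType R) (F : seq (letter V) -> P) v n :
  symmultilin F -> F (lett n 0 :: v) = 0.
Proof.
move=> hF; have := symmultilin_linear_hd v (-1) hF (gpc0 V n) (gpc0 V n).
by rewrite scaler0 addr0 scaleN1r addNr.
Qed.

Lemma symmultilin_hdD (P : lmodType R) (F : seq (letter V) -> P) v n (y z : V) :
  symmultilin F -> gpc V n y -> gpc V n z ->
  F (lett n (y + z) :: v) = F (lett n y :: v) + F (lett n z :: v).
Proof.
by move=> hF hy hz; have := symmultilin_linear_hd v 1 hF hy hz; rewrite !scale1r.
Qed.

Lemma symmultilin_hdZ (P : lmodType R) (F : seq (letter V) -> P) v n a (y : V) :
  symmultilin F -> gpc V n y -> F (lett n (a *: y) :: v) = a *: F (lett n y :: v).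
Proof.
move=> hF hy; have := symmultilin_linear_hd v a hF hy (gpc0 V n).
by rewrite !addr0 symmultilin_hd0 // addr0.
Qed.

Lemma lmul_lett0 n (y : S) : lmul (lett n 0) y = 0.
Proof.
apply: (@eq_linear_sprod _ (lmul (lett n 0)) (fun _ : S => 0 : S)); first exact: lmul_linear.
  by move=> a x z; rewrite scaler0 addr0.
by move=> w; rewrite lmul_sprod (symmultilin_hd0 _ _ sprod_symmultilin).
Qed.

Lemma symmultilin_move (P : lmodType R) (F : seq (letter V) -> P) u v x :
  symmultilin F -> F (u ++ x :: v) = sgn (ldeg x * wdeg u) *: F (x :: u ++ v).
Proof.
move=> hF; elim/last_ind: u v => [|u y IH] v.
  by rewrite wdeg_nil mulr0 sgn0 scale1r.
rewrite !cat_rcons hF.2 IH wdeg_rcons scalerA; congr (_ *: _); sgn_solve.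
Qed.

Lemma symmultilin_rcons (P : lmodType R) (F : seq (letter V) -> P) v x :
  symmultilin F -> F (x :: v) = sgn (ldeg x * wdeg v) *: F (rcons v x).
Proof.
by move=> hF; rewrite -cats1 symmultilin_move // cats0 scaler_sgnK.
Qed.

End SymmetricWords.

Lemma lett_lval (V : gmod R) (x : letter V) n : n = ldeg x -> lett n (lval x) = x.
Proof.
by move=> ->; apply/val_inj; rewrite /lett insubdK -?surjective_pairing //; exact: letterP.
Qed.

Section Convolve.
Context (L : complex R) (M N : gmod R) (P : lmodType R).
Context (b : letter M -> letter N -> P) (m n : int).
Context (f : symg (susp L) -> M) (g : symg (susp L) -> N).
Hypotheses (hb : letter_bilinear b) (hf : hom_deg m f) (hg : hom_deg n g).

Lemma convolve_linear : linear (convolve b m n f g).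
Proof.
move=> a x y; rewrite /convolve diag_linear (tmap_linear hf hg).
exact: tlift_linear.
Qed.

Lemma convolve_sprod w : convolve b m n f g (sprod w) =
  unshuffle_sum (fun u v => sgn (n * wdeg u) *:
    b (lett (wdeg u + m) (f (sprod u))) (lett (wdeg v + n) (g (sprod v)))) w.
Proof. exact: tlift_tmap_diag. Qed.

End Convolve.
End GradedMaps.
(** * Coderivations *)

Section WordCoderivations.
Context {R : comNzRingType} {V : gmod R}.
Local Notation S := (symg V).
Implicit Types (u v w : seq (letter V)) (x y : letter V) (c : seq (letter V) -> V).

Definition constit c : Prop :=
  symmultilin c /\ forall w, gpc V (wdeg w - 1) (c w).

Definition clett c w : letter V := lett (wdeg w - 1) (c w).

Definition cod c w : S := unshuffle_sum (fun u v => sprod (clett c u :: v)) w.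

Definition cmask (k : nat) c w : V := if size w == k then c w else 0.

Section Constit.
Context (c : seq (letter V) -> V) (hc : constit c).

Lemma ldeg_clett w : ldeg (clett c w) = wdeg w - 1.
Proof. exact: (lettE (hc.2 w)).1. Qed.

Lemma lval_clett w : lval (clett c w) = c w.
Proof. exact: (lettE (hc.2 w)).2. Qed.

Lemma clett_symmultilin (P : lmodType R) (F : seq (letter V) -> P) v :
  symmultilin F -> symmultilin (fun u => F (clett c u :: v)).
Proof.
move=> hF; split=> [u z a x y x' h|u z x y]; rewrite /clett.
  have [e1 e2] := wdeg_lin u z h; rewrite (hc.1.1 _ _ _ _ _ _ h) e1 e2.
  by apply: symmultilin_linear_hd => //; [|rewrite -e2]; exact: hc.2.
have e : wdeg (u ++ [:: x, y & z]) = wdeg (u ++ [:: y, x & z]).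
  by rewrite !wdeg_cat !wdeg_cons; congr (_ + _); rewrite addrCA.
rewrite e hc.1.2; apply: symmultilin_hdZ => //; exact: hc.2.
Qed.

Lemma cod_symmultilin : symmultilin (cod c).
Proof.
apply: unshuffle_sum_symmultilin; split=> [v|u].
  exact: clett_symmultilin sprod_symmultilin.
exact: lmul_symmultilin.
Qed.

Lemma clett_hd0 w (P : lmodType R) (F : seq (letter V) -> P) v :
  symmultilin F -> c w = 0 -> F (clett c w :: v) = 0.
Proof. by move=> hF e; rewrite /clett e symmultilin_hd0. Qed.

Lemma cmask_constit k : constit (cmask k c).
Proof.
split; first exact: (symmultilin_mask (fun i => i == k) hc.1).
by move=> w; rewrite /cmask; case: ifP => _; [exact: hc.2|exact: gpc0].
Qed.

Lemma cod_linear (P : lmodType R) (f : S -> P) w : linear f ->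
  f (cod c w) = unshuffle_sum (fun u v => f (sprod (clett c u :: v))) w.
Proof. exact: usum_linear. Qed.

(* The coderivation law of cod c, paired with a form B in two variables. *)
Lemma cod_coderivation (P : lmodType R)
    (B : seq (letter V) -> seq (letter V) -> P) w :
  unshuffle_sum (fun u v => unshuffle_sum B (clett c u :: v)) w =
  unshuffle_sum (fun u v => unshuffle_sum (fun u1 u2 => B (clett c u1 :: u2) v) u
    + sgn (wdeg u) *: unshuffle_sum (fun v1 v2 => B u (clett c v1 :: v2)) v) w.
Proof.
transitivity (usum3 (fun u v1 v2 => B (clett c u :: v1) v2
    + sgn ((wdeg u - 1) * wdeg v1) *: B v1 (clett c u :: v2)) w).
  apply: eq_usum => u v _ _; rewrite unshuffle_sum_cons -usumD ldeg_clett.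
  by apply: eq_usum.
rewrite usum3D usumD usum_coassoc; congr (_ + _).
rewrite usum3_swap; apply: eq_usum => u v _ _; rewrite -usumZ.
apply: eq_usum => v1 v2 _ _; rewrite scalerA; congr (_ *: _); sgn_solve.
Qed.

End Constit.

(** Discarding the unshuffles with |u| different from k amounts to masking c, because a word with
    zero head vanishes. All coderivations thereby take the one form [cod]. *)
Lemma coder_linext k c : constit c -> coder k c = linext (cod (cmask k c)) :> (S -> S).
Proof.
move=> hc; rewrite /coder; congr linext; apply/funext => w.
rewrite big_mkcond; apply: eq_bigr => p _; rewrite /clett /cmask; case: ifP => // _.
by rewrite symmultilin_hd0 ?scaler0 //; exact: sprod_symmultilin.
Qed.

Lemma coder_linear k c : constit c -> linear (coder k c : S -> S).
Proof.
move=> hc; rewrite coder_linext //; apply: linext_sym_linear.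
exact/cod_symmultilin/cmask_constit.
Qed.

Lemma coderE k c w : constit c -> coder k c (sprod w) = cod (cmask k c) w.
Proof.
move=> hc; rewrite coder_linext //; apply: linext_sprod.
exact/cod_symmultilin/cmask_constit.
Qed.

(** A representative of y as a combination of words bounds the lengths that occur, so y is the
    finite sum of its components. *)
Lemma wproj_sum0 (y : S) : (forall k, wproj k y = 0) -> y = 0.
Proof.
move=> h; have [s e] := presented_sum y.
pose N := (\max_(p <- s) size p.2).+1.
suff -> : y = \sum_(k < N) wproj k y by rewrite big1.
have eW k : wproj k y = \sum_(p <- s) p.1 *: (if size p.2 == k then sprod p.2 else 0).
  rewrite e (linear_fun_sum (wproj_linear k)); apply: eq_bigr => p _.
  by rewrite (linear_funZ (wproj_linear k)) wproj_sprod.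
under [RHS]eq_bigr => k _ do rewrite eW.
rewrite exchange_big /= e !big_seq; apply: eq_bigr => p ps.
have hp : (size p.2 < N)%N.
  by rewrite ltnS; apply: (@leq_bigmax_seq _ s xpredT (fun p => size p.2) p).
rewrite (bigD1 (Ordinal hp)) //= eqxx big1 ?addr0 // => k /negP hk.
by case: eqP => [ek|]; rewrite ?scaler0 //; case: hk; apply/eqP/val_inj.
Qed.

(* The composite of the diagonal, corest (x) id and the product; on words of
   length k it is multiplication by k. *)
Definition euler_pairing (x y : letter S) : S :=
  lmul (lett (ldeg x) (corest (lval x))) (lval y).

Lemma euler_pairing_bilinear : letter_bilinear euler_pairing.
Proof.
have [lc dc] := @corest_hom R V.
have d (x : letter S) : gpc V (ldeg x) (corest (lval x)).
  by have := dc _ _ (lval_gpc x); rewrite addr0.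
split=> [a x x' z y h|a x y y' z [_ _ e]].
  apply: lmul_llin; have [e e' ez] := h.
  by split; rewrite ?(lettE (d _)).1 ?(lettE (d _)).2 // ez lc.
by rewrite /euler_pairing e lmul_linear.
Qed.

Definition euler (y : S) : S := tlift euler_pairing (diag y).

Lemma euler_linear : linear euler.
Proof.
move=> a x y; rewrite /euler diag_linear; exact: tlift_linear euler_pairing_bilinear _ _ _.
Qed.

Lemma euler_pairing_sletter u v : 
  euler_pairing (sletter u) (sletter v) = if u is [:: x] then sprod (x :: v) else 0.
Proof.
rewrite /euler_pairing ldeg_sletter !lval_sletter corest_sprod lmul_sprod.
case: u => [|x [|y u]]; try by rewrite (symmultilin_hd0 _ _ sprod_symmultilin).
by rewrite wdeg_seq1 lett_lval.
Qed.

Lemma euler_usum w : euler (sprod w) =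
  unshuffle_sum (fun u v => if u is [:: x] then sprod (x :: v) else 0) w.
Proof.
rewrite /euler tlift_diag; last exact: euler_pairing_bilinear.
by apply: eq_usum => u v _ _; rewrite euler_pairing_sletter.
Qed.

Lemma euler_sprod w : euler (sprod w) = (size w)%:R *: sprod w.
Proof.
rewrite euler_usum; elim: w => [|x w IH]; first by rewrite usum_nil scale0r.
transitivity (sprod (x :: w) + lmul x ((size w)%:R *: sprod w)); last first.
  by rewrite (linear_funZ (lmul_linear x)) lmul_sprod -{1}[sprod _]scale1r -scalerDl -mulrS.
rewrite unshuffle_sum_cons; congr (_ + _); first by rewrite usum_unitl //; case.
rewrite -IH (usum_linear _ _ (lmul_linear x)); apply: eq_usum.
move=> [|y [|z u]] v _ _; rewrite ?scaler0 ?(linear_fun0 (lmul_linear x)) //.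
rewrite lmul_sprod ((@sprod_symmultilin R V).2 [::]) /=.
by rewrite wdeg_seq1 mulrC [ldeg y * _]mulrC scalerA; rewrite sgn2 scale1r.
Qed.

Lemma wproj_euler k (y : S) : wproj k (euler y) = k%:R *: wproj k y.
Proof.
have lw := wproj_linear (V := V) k.
apply: (@eq_linear_sprod _ _ _ (fun y : S => wproj k (euler y)) (fun y : S => k%:R *: wproj k y)).
- by move=> a x z; rewrite euler_linear lw.
- by move=> a x z; rewrite lw scalerDr !scalerA mulrC.
move=> w; rewrite euler_sprod (linear_funZ lw) wproj_sprod.
by case: eqP => [->|]; rewrite ?scaler0.
Qed.

End WordCoderivations.

(** * Coderivations are determined by their constituents *)

Section Determined.
Context {R : comNzRingType} (iota : {rmorphism rat -> R}) {V : gmod R}.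
Local Notation S := (symg V).
Implicit Types (u v w : seq (letter V)).

Lemma natr_scale_inj (M : lmodType R) k (x : M) : (0 < k)%N -> k%:R *: x = 0 -> x = 0.
Proof.
move=> hk e; rewrite -[x]scale1r -(rmorph1 iota).
have k0 : k%:R != 0 :> rat by rewrite Num.Theory.pnatr_eq0 -lt0n.
by rewrite -(mulVf k0) rmorphM rmorph_nat -scalerA e scaler0.
Qed.

(** On the component of length k the Euler map is multiplication by k, injective for k > 0 since R
    contains the rationals. It kills length 0, which must be controlled separately. *)
Lemma euler_inj (y : S) : wproj 0 y = 0 -> euler y = 0 -> y = 0.
Proof.
move=> h0 h; apply: wproj_sum0 => -[|k] //; apply: (@natr_scale_inj _ k.+1) => //.
by rewrite -wproj_euler h (linear_fun0 (wproj_linear _)).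
Qed.

Context (f : S -> S) (hf : hom_deg (-1) f) (cf : is_coderivation f).

Lemma counit_symmultilin :
  symmultilin (fun w : seq (letter V) => if w is [::] then 1 else 0 : R^o).
Proof.
split=> [[|t u] v a x y z|[|t u] v x y] /=; by rewrite ?scaler0 ?addr0.
Qed.

Definition counit : S -> R^o := linext (fun w => if w is [::] then 1 else 0 : R^o).

Lemma counit_linear : linear counit.
Proof. exact: linext_sym_linear counit_symmultilin. Qed.

Lemma counit_sprod w : counit (sprod w) = if w is [::] then 1 else 0.
Proof. exact: linext_sprod counit_symmultilin. Qed.

Lemma wproj0E (y : S) : wproj 0 y = (counit y : R) *: sprod [::].
Proof.
apply: (@eq_linear_sprod _ _ _ _ (fun y : S => (counit y : R) *: sprod [::] : S)).
- exact: wproj_linear.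
- by move=> a x z; rewrite counit_linear scalerDl scalerA.
move=> w; rewrite wproj_sprod counit_sprod.
by case: w => [|x w]; rewrite ?scale1r ?scale0r.
Qed.

(** Paired with the counit in both factors, the coderivation law expresses the counit of
    [f (sprod w)] as twice itself. *)
Lemma coderivation_counit w : counit (f (sprod w)) = 0.
Proof.
pose b (x y : letter S) : R^o := counit (lval x) * counit (lval y).
have hb : letter_bilinear b.
  split=> [a x x' z y [_ _ e]|a x y y' z [_ _ e]]; rewrite /b e counit_linear.
    by rewrite mulrDl -scalerAl.
  by rewrite mulrDr -scalerAr.
have bE y : tlift b (diag y) = counit y.
  apply: (@eq_linear_sprod _ _ _ (fun y : S => tlift b (diag y)) counit).
  - by move=> a x z; rewrite diag_linear; exact: tlift_linear.
  - exact: counit_linear.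
  move=> u; rewrite tlift_diag // /b usum_unitl => [|p q hp].
    by rewrite !lval_sletter counit_sprod mul1r.
  by rewrite !lval_sletter counit_sprod; case: p hp => // *; rewrite mul0r.
have sE u : lett (wdeg u + 0) (sprod u : S) = sletter u by rewrite addr0.
have lE u : lval (lett (wdeg u - 1) (f (sprod u)) : letter S) = f (sprod u).
  exact: (lettE (hom_deg_gpc _ hf)).2.
have e : counit (f (sprod w)) = counit (f (sprod w)) + counit (f (sprod w)).
  rewrite -{1}bE cf (linear_funD (tlift_linear hb)).
  rewrite !tlift_tmap_diag //; try exact: id_hom.
  congr (_ + _).
    rewrite usum_unitr => [|u v hv].
      by rewrite sE mul0r sgn0 scale1r /b lE lval_sletter counit_sprod mulr1.
    rewrite sE /b lval_sletter counit_sprod.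
    by case: v hv => // *; rewrite mulr0 scaler0.
  rewrite usum_unitl => [|u v hv].
    by rewrite sE wdeg_nil mulr0 sgn0 scale1r /b lE lval_sletter counit_sprod mul1r.
  rewrite sE /b lval_sletter counit_sprod.
  by case: u hv => // *; rewrite mul0r scaler0.
by apply: (addIr (counit (f (sprod w)))); rewrite add0r -e.
Qed.

Lemma corest_constit : constit (fun w => corest (f (sprod w))).
Proof.
have [lc dc] := @corest_hom R V.
split.
  by apply: (@linear_symmultilin _ _ _ (fun y : S => corest (f y))) => a x y; rewrite hf.1 lc.
by move=> w; rewrite -[_ - 1]addr0; apply: dc; exact: hom_deg_gpc.
Qed.

(* Applying the Euler map to both sides: by induction on the length of w,
   euler (f w) = sum (1 + |v|) c(u) v over the unshuffles (u, v) of w, where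
   c = corest o f, and this is euler (cod c w). *)
Lemma coderivation_cod w : f (sprod w) = cod (fun w => corest (f (sprod w))) w.
Proof.
set c := fun w => _; have hc : constit c := corest_constit.
have [n] := ubnP (size w); elim: n w => // n IH w; rewrite ltnS => hw.
apply/eqP; rewrite -subr_eq0; apply/eqP; apply: euler_inj.
  (* Neither side has a component of length 0: the left one by [coderivation_counit], the right one
     because its words all have a head letter. *)
  rewrite wproj0E (linear_funB counit_linear) coderivation_counit sub0r.
  rewrite (cod_linear _ _ counit_linear) usum_eq0 ?oppr0 ?scale0r // => u v _ _.
  by rewrite counit_sprod.
rewrite (linear_funB euler_linear); apply/eqP; rewrite subr_eq0; apply/eqP.
rewrite (cod_linear _ _ euler_linear).
have hb := @euler_pairing_bilinear R V.
rewrite {1}/euler cf (linear_funD (tlift_linear hb)).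
rewrite !tlift_tmap_diag //; try exact: id_hom.
have sE u : lett (wdeg u + 0) (sprod u : S) = sletter u by rewrite addr0.
have E1 u v : euler_pairing (lett (wdeg u + -1) (f (sprod u))) (sletter v) =
    sprod (clett c u :: v).
  rewrite /euler_pairing (lettE (hom_deg_gpc _ hf)).1 (lettE (hom_deg_gpc _ hf)).2.
  by rewrite lval_sletter lmul_sprod.
under eq_usum => u v _ _ do rewrite sE E1 mul0r sgn0 scale1r.
have -> : unshuffle_sum (fun u v => sgn (-1 * wdeg u) *:
      euler_pairing (lett (wdeg u + 0) (sprod u : S)) (lett (wdeg v + -1) (f (sprod v)))) w =
    usum3 (fun u v1 v2 => sgn (wdeg u) *:
      if u is [:: x] then sprod [:: x, clett c v1 & v2] else 0) w.
  apply: eq_usum => u v _ hs; rewrite sE /euler_pairing ldeg_sletter lval_sletter.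
  rewrite (lettE (hom_deg_gpc _ hf)).2 corest_sprod.
  case: u hs => [|x [|y u]] hs.
  - by rewrite lmul_lett0 scaler0 usum_eq0 // => *; rewrite scaler0.
  - rewrite usumZ; congr (_ *: _); first by sgn_solve.
    (* Here u is the single letter x, so v is shorter than w. *)
    rewrite IH; last by move: hw; rewrite hs.
    rewrite (usum_linear _ _ (lmul_linear _)); apply: eq_usum => v1 v2 _ _.
    by rewrite lmul_sprod wdeg_seq1 lett_lval.
  - by rewrite lmul_lett0 scaler0 usum_eq0 // => *; rewrite scaler0.
(* The swap makes the block fed to [c] the outer one. What remains is the Euler sum of v behind the
   letter [clett c u], that is, |v| times the word. *)
rewrite usum3_swap -usumD; apply: eq_usum => u v _ _.
rewrite euler_sprod /= mulrS scalerDl scale1r; congr (_ + _).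
have -> : (size v)%:R *: sprod (clett c u :: v) = lmul (clett c u) (euler (sprod v)).
  by rewrite euler_sprod (linear_funZ (lmul_linear _)) lmul_sprod.
rewrite euler_usum (usum_linear _ _ (lmul_linear _)); apply: eq_usum => v1 v2 _ _.
case: v1 => [|x [|y v1]]; rewrite ?scaler0 ?(linear_fun0 (lmul_linear _)) //.
rewrite lmul_sprod ((@sprod_symmultilin R V).2 [::]) !scalerA wdeg_seq1 ldeg_clett //.
rewrite -[RHS]scale1r; congr (_ *: _); rewrite -(@sgn0 R); sgn_solve.
Qed.

End Determined.
(** * The operators of a pair (tau, c) *)

Section CdgaFacts.
Context {R : comNzRingType} (A : cdga R).

Lemma cmul_gpc i j (a b : A) : gpc A i a -> gpc A j b -> gpc A (i + j) (cmul a b).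
Proof. exact: (gcalg_deg (cdga_alg (cdgaP A))). Qed.

Lemma cmul0l (b : A) : cmul 0 b = 0.
Proof. exact: (linear_fun0 (cmul_linl b)). Qed.

Lemma cmul0r (a : A) : cmul a 0 = 0.
Proof. exact: (linear_fun0 (cmul_linr a)). Qed.

Lemma cmulZl k (a b : A) : cmul (k *: a) b = k *: cmul a b.
Proof. exact: (linear_funZ (cmul_linl b)). Qed.

Lemma cmulZr k (a b : A) : cmul a (k *: b) = k *: cmul a b.
Proof. exact: (linear_funZ (cmul_linr a)). Qed.

Lemma cmulDl (a a' b : A) : cmul (a + a') b = cmul a b + cmul a' b.
Proof. exact: (linear_funD (cmul_linl b)). Qed.

Lemma cmulDr (a b b' : A) : cmul a (b + b') = cmul a b + cmul a b'.
Proof. exact: (linear_funD (cmul_linr a)). Qed.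

(** The derivation law of a differential graded algebra is given for two homogeneous factors, but
    [der_deg] leaves the second one arbitrary; it is decomposed by directness of A. *)
Lemma cx_d_der : gpc (Der A) (-1) (@cx_d R A).
Proof.
have [dlin dl] := cdga_der (cdgaP A); split.
  by split; [exact: cx_lin|exact: (glin_deg dlin)].
move=> i a b ha; have := cx_direct A => -[/(_ b)[s [f [hf ->]]] _].
rewrite !(linear_fun_sum (cmul_linr _)) !(linear_fun_sum (@cx_lin _ A)).
rewrite (linear_fun_sum (cmul_linr _)) scaler_sumr -big_split.
by apply: eq_bigr => j _; exact: (dl _ _ _ _ ha (hf j)).
Qed.

End CdgaFacts.

Section Convolutions.
Context {R : comNzRingType} {L : complex R} {A : cdga R}.
Local Notation V := (susp L).
Local Notation S := (symg V).
Implicit Types (u v w : seq (letter V)) (f g : S -> A).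

Lemma mul_pairing_bilinear : letter_bilinear (@mul_pairing R A).
Proof.
by split=> [a x x' z y|a x y y' z] [_ _ e]; rewrite /mul_pairing e ?cmul_linl ?cmul_linr.
Qed.

Lemma eval_pairing_bilinear : letter_bilinear (@eval_pairing R A).
Proof.
split=> [a x x' z y|a x y y' z] [_ _ e]; rewrite /eval_pairing e //.
by have [[lx _] _] := lval_gpc x; rewrite lx.
Qed.

Lemma der_bracket_bilinear : letter_bilinear (@der_bracket R A).
Proof.
split=> [a x x' z y|a x y y' z] [e1 e2 e]; apply/funext => b;
  rewrite /der_bracket !fctE /= e1 e2 e !fctE.
  have [[ly _] _] := lval_gpc y; rewrite ly !scalerDr !scalerA opprD addrACA.
  by rewrite scalerN scalerA [a * _]mulrC.
have [[lx _] _] := lval_gpc x; rewrite lx !scalerDr !scalerA opprD addrACA.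
by rewrite scalerN scalerA [a * _]mulrC.
Qed.

Lemma cup_linear m n f g : hom_deg m f -> hom_deg n g ->
  linear (cup m n (f : Hom_SA L A) g).
Proof. by move=> hf hg; apply: convolve_linear => //; exact: mul_pairing_bilinear. Qed.

Lemma cup_sprod m n f g w : hom_deg m f -> hom_deg n g ->
  cup m n (f : Hom_SA L A) g (sprod w) = unshuffle_sum (fun u v =>
    sgn (n * wdeg u) *: cmul (f (sprod u)) (g (sprod v))) w.
Proof.
move=> hf hg; rewrite /cup convolve_sprod //; last exact: mul_pairing_bilinear.
apply: eq_usum => u v _ _; rewrite /mul_pairing.
by rewrite (lettE (hom_deg_gpc _ hf)).2 (lettE (hom_deg_gpc _ hg)).2.
Qed.

Lemma cup_hom m n f g : hom_deg m f -> hom_deg n g ->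
  hom_deg (m + n) (cup m n (f : Hom_SA L A) g).
Proof.
move=> hf hg; apply: hom_deg_sprod; first exact: cup_linear.
move=> w; rewrite cup_sprod //; apply: gpc_usum => u v ->.
by apply: gpcZ; rewrite addrACA; apply: cmul_gpc; apply: hom_deg_gpc.
Qed.

End Convolutions.

Section Operator.
Context {R : comNzRingType} {L : complex R} {A : cdga R}.
Local Notation V := (susp L).
Local Notation S := (symg V).
Implicit Types (u v w : seq (letter V)) (f g : S -> A).
Context (tau : seq (letter V) -> Der A) (c : seq (letter V) -> V).
Hypotheses (dtau : forall w, gpc (Der A) (wdeg w - 1) (tau w)) (hc : constit c).

(** The first sign is that of f, of degree n, passing u; the second is the one of the
    Hom-differential and of [pd_star]. *)
Definition opD (n : int) f w : A := unshuffle_sum (fun u v =>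
  sgn (n * wdeg u) *: tau u (f (sprod v)) + sgn (n + 1) *: f (sprod (clett c u :: v))) w.

Lemma tau_linear w : linear (tau w).
Proof. by have [[]] := dtau w. Qed.

Lemma tau_gpc w i a : gpc A i a -> gpc A (i + (wdeg w - 1)) (tau w a).
Proof. by have [[_ h] _] := dtau w; exact: h. Qed.

Lemma tau_leibniz w i a b : gpc A i a ->
  tau w (cmul a b) = cmul (tau w a) b + sgn ((wdeg w - 1) * i) *: cmul a (tau w b).
Proof. by have [_] := dtau w; exact. Qed.

Lemma opD_gpc n f w : hom_deg n f -> gpc A (wdeg w + (n - 1)) (opD n f w).
Proof.
move=> hf; apply: gpc_usum => u v ->; apply: gpcDr; apply: gpcZ.
  have := tau_gpc u (hom_deg_gpc v hf).
  by congr (gpc A _ _); ring.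
have := hom_deg_gpc (clett c u :: v) hf; rewrite wdeg_cons ldeg_clett //.
by congr (gpc A _ _); ring.
Qed.

Lemma opD_lin n k f g w : opD n (k *: f + g) w = k *: opD n f w + opD n g w.
Proof.
rewrite -usumZ -usumD; apply: eq_usum => u v _ _.
rewrite !fctE tau_linear !scalerDr !scalerA ![k * _]mulrC.
by rewrite addrACA.
Qed.

Lemma opD_leibniz i j f g (F G : S -> A) w :
  hom_deg i f -> hom_deg j g -> hom_deg (i - 1) F -> hom_deg (j - 1) G ->
  (forall w, F (sprod w) = opD i f w) -> (forall w, G (sprod w) = opD j g w) ->
  opD (i + j) (cup i j (f : Hom_SA L A) g) w =
    cup (i - 1) j (F : Hom_SA L A) g (sprod w)
    + sgn (-1 * i) *: cup i (j - 1) (f : Hom_SA L A) G (sprod w).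
Proof.
move=> hf hg hF hG FE GE; rewrite !cup_sprod // /opD usumD.
(* By the coderivation law the letter c(u) enters the argument of f or that of g. *)
have -> : unshuffle_sum (fun u v => sgn (i + j + 1) *:
    cup i j (f : Hom_SA L A) g (sprod (clett c u :: v))) w =
  unshuffle_sum (fun u v => unshuffle_sum (fun u1 u2 => sgn (j * (wdeg u - 1) + i + j + 1) *:
      cmul (f (sprod (clett c u1 :: u2))) (g (sprod v))) u) w
  + unshuffle_sum (fun u v => unshuffle_sum (fun v1 v2 => sgn (wdeg u + j * wdeg u + i + j + 1) *:
      cmul (f (sprod u)) (g (sprod (clett c v1 :: v2)))) v) w.
  rewrite usumZ; under eq_usum => u v _ _ do rewrite cup_sprod //.
  rewrite cod_coderivation // -usumZ -usumD; apply: eq_usum => u v _ _.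
  rewrite scalerDr scalerA -!usumZ; congr (_ + _); apply: eq_usum => u1 u2 e _.
    by rewrite wdeg_cons ldeg_clett // e scalerA; congr (_ *: _); sgn_solve.
  by rewrite scalerA; congr (_ *: _); sgn_solve.
have -> : unshuffle_sum (fun u v => sgn ((i + j) * wdeg u) *:
    tau u (cup i j (f : Hom_SA L A) g (sprod v))) w =
  usum3 (fun u v1 v2 => sgn ((i + j) * wdeg u + j * wdeg v1) *:
      cmul (tau u (f (sprod v1))) (g (sprod v2))) w
  + usum3 (fun u v1 v2 => sgn ((i + j) * wdeg u + j * wdeg v1
        + (wdeg u - 1) * (wdeg v1 + i)) *:
      cmul (f (sprod v1)) (tau u (g (sprod v2)))) w.
  rewrite -usum3D; apply: eq_usum => u v _ _; rewrite cup_sprod //.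
  rewrite (usum_linear _ _ (tau_linear u)) -usumZ; apply: eq_usum => v1 v2 _ _.
  rewrite (linear_funZ (tau_linear u)) (tau_leibniz _ _ (hom_deg_gpc v1 hf)).
  by rewrite !scalerDr !scalerA -!sgnD -addrA.
have -> : unshuffle_sum (fun u v => sgn (j * wdeg u) *: cmul (F (sprod u)) (g (sprod v))) w =
  usum3 (fun u v1 v2 => sgn ((i + j) * wdeg u + j * wdeg v1) *:
      cmul (tau u (f (sprod v1))) (g (sprod v2))) w
  + unshuffle_sum (fun u v => unshuffle_sum (fun u1 u2 => sgn (j * (wdeg u - 1) + i + j + 1) *:
      cmul (f (sprod (clett c u1 :: u2))) (g (sprod v))) u) w.
  rewrite -usum_coassoc -usumD; apply: eq_usum => u v _ _.
  rewrite FE /opD (usum_linear _ _ (cmul_linl _)) -usumZ -usumD; apply: eq_usum => u1 u2 e _.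
  rewrite cmulDl !cmulZl scalerDr !scalerA e; congr (_ *: _ + _ *: _); sgn_solve.
have -> : sgn (-1 * i) *: unshuffle_sum (fun u v => sgn ((j - 1) * wdeg u) *:
      cmul (f (sprod u)) (G (sprod v))) w =
  usum3 (fun u v1 v2 => sgn ((i + j) * wdeg u + j * wdeg v1
        + (wdeg u - 1) * (wdeg v1 + i)) *:
      cmul (f (sprod v1)) (tau u (g (sprod v2)))) w
  + unshuffle_sum (fun u v => unshuffle_sum (fun v1 v2 => sgn (wdeg u + j * wdeg u + i + j + 1) *:
      cmul (f (sprod u)) (g (sprod (clett c v1 :: v2)))) v) w.
  (* Here tau(u) acts behind the value of f, so the first two blocks are exchanged. *)
  rewrite usum3_swap -usumZ -usumD; apply: eq_usum => u v _ _.
  rewrite GE /opD (usum_linear _ _ (cmul_linr _)) -!usumZ -usumD; apply: eq_usum => v1 v2 _ _.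
  rewrite cmulDr !cmulZr !scalerDr !scalerA; congr (_ *: _ + _ *: _); sgn_solve.
by rewrite -!addrA; congr (_ + _); rewrite addrCA.
Qed.

End Operator.

(** * Multilinearity over A *)

Section Multilinear.
Context {R : comNzRingType} {L : complex R} {A : cdga R}.
Local Notation V := (susp L).
Local Notation S := (symg V).
Implicit Types (u v w : seq (letter V)) (a : letter A) (x : letter V).
Context (act : A -> L -> L) (hact : is_dgmodule act).

Lemma sact_gpc i j (a : A) (y : V) :
  gpc A i a -> gpc V j y -> gpc V (i + j) (sact act i a y).
Proof.
move=> ha hy; apply: gpcZ; have := dgm_deg hact ha (hy : gpc L (j - 1) y).
by rewrite /= addrA.
Qed.

Lemma lact_gpc a x : gpc V (ldeg a + ldeg x) (sact act (ldeg a) (lval a) (lval x)).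
Proof. by apply: sact_gpc; exact: lval_gpc. Qed.

Lemma ldeg_lact a x : ldeg (lact act a x) = ldeg a + ldeg x.
Proof. exact: (lettE (lact_gpc a x)).1. Qed.

Lemma lval_lact a x : lval (lact act a x) = sact act (ldeg a) (lval a) (lval x).
Proof. exact: (lettE (lact_gpc a x)).2. Qed.

Lemma symmultilin_move_last (P : lmodType R) (F : seq (letter V) -> P) u v x :
  symmultilin F -> F (u ++ x :: v) = sgn (ldeg x * wdeg v) *: F (rcons (u ++ v) x).
Proof.
move=> hF; rewrite symmultilin_move // (symmultilin_rcons _ _ hF) wdeg_cat scalerA.
congr (_ *: _); sgn_solve.
Qed.

(** Graded symmetry carries any letter to the end of the word. The signs for x and for a x differ by
    a power depending on |a|, which is the sign of a passing the letters behind it. *)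
Lemma amultilinear_last (M : lmodType R) (am : A -> M -> M) m (f : S -> M) :
  linear f -> (forall b : A, linear (am b)) ->
  (forall u a x, f (sprod (rcons u (lact act a x))) =
     sgn (ldeg a * (m + wdeg u)) *: am (lval a) (f (sprod (rcons u x)))) ->
  amultilinear act am m f.
Proof.
move=> lf la h u v a x; have hF := linear_symmultilin lf.
rewrite !(symmultilin_move_last u v _ hF) h (linear_funZ (la _)) !scalerA.
rewrite ldeg_lact wdeg_cat; congr (_ *: _); sgn_solve.
Qed.

Lemma amultilinear_rcons (M : lmodType R) (am : A -> M -> M) m (f : S -> M) :
  amultilinear act am m f -> forall u a x, f (sprod (rcons u (lact act a x))) =
     sgn (ldeg a * (m + wdeg u)) *: am (lval a) (f (sprod (rcons u x))).
Proof. by move=> h u a x; rewrite -!cats1; exact: h. Qed.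

(** The last letter lies in the argument of g or of f; in the first case a also passes the value of
    f, by graded commutativity of A. *)
Lemma cup_sym m n (f g : Sym act) : sym_deg act m f -> sym_deg act n g ->
  sym_deg act (m + n) (cup m n (f : Hom_SA L A) g).
Proof.
move=> [hf af] [hg ag]; split; first exact: cup_hom.
apply: amultilinear_last => [||u a x]; [exact: cup_linear|exact: cmul_linr|].
have assoc := gcalg_assoc (cdga_alg (cdgaP A)).
have comm := gcalg_comm (cdga_alg (cdgaP A)).
rewrite !cup_sprod // !usum_rcons (linear_funD (cmul_linr _)) scalerDr.
rewrite !(usum_linear _ _ (cmul_linr _)) -!usumZ; congr (_ + _); apply: eq_usum => p q e _.
  rewrite (amultilinear_rcons ag) !cmulZr !scalerA e.
  rewrite (assoc _ _ _ _ _ _ (hom_deg_gpc p hf) (lval_gpc a) (hom_deg_gpc (rcons q x) hg)).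
  rewrite (comm _ _ _ _ (hom_deg_gpc p hf) (lval_gpc a)) cmulZl.
  rewrite -(assoc _ _ _ _ _ _ (lval_gpc a) (hom_deg_gpc p hf) (hom_deg_gpc (rcons q x) hg)).
  rewrite scalerA; congr (_ *: _); sgn_solve.
rewrite (amultilinear_rcons af) !cmulZl !cmulZr !scalerA e !wdeg_rcons ldeg_lact.
rewrite -(assoc _ _ _ _ _ _ (lval_gpc a) (hom_deg_gpc (rcons p x) hf) (hom_deg_gpc q hg)).
congr (_ *: _); sgn_solve.
Qed.

(** Bookkeeping for [opD_act]: y1 is the term tau(u)(a) f(v, x) that the Leibniz rule of tau(u)
    produces, and z is the same product with opposite sign, coming from the summand tau(u)(a) x of
    c(u, a x). *)
Lemma cancel_across (M : zmodType) (y1 y2 y3 y4 y5 z : M) :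
  y1 + z = 0 -> y1 + y2 + y3 + (y4 + (z + y5)) = y2 + y3 + (y4 + y5).
Proof.
move/eqP; rewrite addr_eq0 => /eqP ->; rewrite [y4 + (z + _)]addrCA -!addrA.
by rewrite [y3 + (z + _)]addrCA [y2 + (z + _)]addrCA addKr.
Qed.

Section OperatorSym.
Context (tau : seq (letter V) -> Der A) (c : seq (letter V) -> V).
Hypotheses (dtau : forall w, gpc (Der A) (wdeg w - 1) (tau w)) (hc : constit c).
Hypothesis tau_act : forall u a x b, tau (rcons u (lact act a x)) b =
  sgn (ldeg a * (wdeg u - 1)) *: cmul (lval a) (tau (rcons u x) b).
Hypothesis c_act : forall u a x, c (rcons u (lact act a x)) =
  sact act (wdeg u - 1 + ldeg a) (tau u (lval a)) (lval x)
  + sgn ((wdeg u + 1) * ldeg a) *: sact act (ldeg a) (lval a) (c (rcons u x)).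

Lemma clett_act n (f : S -> A) u v a x : sym_deg act n f ->
  f (sprod (clett c (rcons u (lact act a x)) :: v)) =
    sgn ((wdeg u - 1 + ldeg a) * n + ldeg x * wdeg v) *:
       cmul (tau u (lval a)) (f (sprod (rcons v x)))
    + sgn ((wdeg u + 1 + n) * ldeg a) *:
       cmul (lval a) (f (sprod (clett c (rcons u x) :: v))).
Proof.
move=> [[lf df] af]; have hF := linear_symmultilin lf.
have ht := tau_gpc dtau u (lval_gpc a); have hx := lval_gpc x.
have h1 := sact_gpc ht hx.
have h2 := sact_gpc (lval_gpc a) (hc.2 (rcons u x)).
rewrite /clett c_act wdeg_rcons ldeg_lact.
(* Both summands of c(u, a x) must be seen in the same degree, since [lett] replaces an element not
   of the given degree by zero. *)
have -> : wdeg u + (ldeg a + ldeg x) - 1 = ldeg a + (wdeg u - 1) + ldeg x by ring.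
have e2 : ldeg a + (wdeg (rcons u x) - 1) = ldeg a + (wdeg u - 1) + ldeg x.
  by rewrite wdeg_rcons; ring.
rewrite e2 in h2; rewrite [wdeg u - 1 + _]addrC.
rewrite (symmultilin_hdD _ hF) //; last exact: gpcZ.
rewrite [X in _ + X](symmultilin_hdZ v _ hF h2); congr (_ + _).
  (* The homogeneous element tau(u)(a) of A now serves as the scalar acting on x. *)
  have := af [::] v (lett (ldeg a + (wdeg u - 1)) (tau u (lval a))) x.
  rewrite /lact (lettE ht).1 (lettE ht).2 /= => ->.
  rewrite wdeg_nil addr0 (symmultilin_rcons _ _ hF) cmulZr scalerA.
  congr (_ *: _); sgn_solve.
have := af [::] v a (clett c (rcons u x)).
rewrite /lact (ldeg_clett hc) (lval_clett hc) e2 /= => ->; rewrite scalerA wdeg_nil addr0.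
congr (_ *: _); sgn_solve.
Qed.

Lemma opD_act n (f : S -> A) u a x : sym_deg act n f ->
  opD tau c n f (rcons u (lact act a x)) =
    sgn (ldeg a * (n - 1 + wdeg u)) *: cmul (lval a) (opD tau c n f (rcons u x)).
Proof.
move=> sf; have [hf af] := sf.
rewrite /opD !usum_rcons (linear_funD (cmul_linr _)) !(usum_linear _ _ (cmul_linr _)).
rewrite scalerDr -!usumZ -!usumD; apply: eq_usum => p q e _.
rewrite !(amultilinear_rcons af) (clett_act _ _ _ _ sf) (linear_funZ (tau_linear dtau p)).
rewrite (tau_leibniz dtau _ _ (lval_gpc a)) tau_act !wdeg_rcons ldeg_lact e.
have -> : f (sprod (clett c p :: rcons q (lact act a x))) =
   sgn (ldeg a * (n + (wdeg p - 1 + wdeg q))) *: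
     cmul (lval a) (f (sprod (clett c p :: rcons q x))).
  by rewrite -rcons_cons (amultilinear_rcons af) wdeg_cons (ldeg_clett hc).
rewrite !cmulDr !cmulZr !scalerDr !scalerA !cmulDr !cmulZr !scalerDr !scalerA.
rewrite (@cancel_across A); first by congr (_ *: _ + _ *: _ + (_ *: _ + _ *: _)); sgn_solve.
rewrite -scalerDl -[RHS](scale0r (cmul (tau p (lval a)) (f (sprod (rcons q x))))).
congr (_ *: _); apply/eqP; rewrite addr_eq0 -!sgnD; apply/eqP/sgn_opp; par_solve.
Qed.


End OperatorSym.
End Multilinear.
(** * The derivations of an sh Lie-Rinehart algebra *)

Section ShLieRinehart.
Context {R : comNzRingType} {iota : {rmorphism rat -> R}} {A : cdga R} {L : complex R}.
Context {act : A -> L -> L}.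
Context {pd : symg (susp L) -> symg (susp L)} {t : symg (susp L) -> Der A}.
Hypothesis hLR : is_shLR act iota pd t.
Local Notation V := (susp L).
Local Notation S := (symg V).
Implicit Types (u v w : seq (letter V)) (a : letter A) (x : letter V) (f g : Hom_SA L A).

Let hact : is_dgmodule act := shlr_module hLR.

Lemma t_hom : hom_deg (-1) t.
Proof. exact: shact_deg (shlr_shaction hLR). Qed.

Lemma pd_hom : hom_deg (-1) pd.
Proof. exact: shl_deg (shlr_shLie hLR). Qed.

Lemma t_sprod j w : t_ t j (sprod w) = if size w == j then t (sprod w) else 0.
Proof.
by rewrite /t_ wproj_sprod; case: ifP => // _; rewrite (linear_fun0 t_hom.1).
Qed.

Lemma t__hom j : hom_deg (-1) (t_ t j).
Proof.
apply: hom_deg_sprod => [k x y|w]; first by rewrite /t_ wproj_linear t_hom.1.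
by rewrite t_sprod; case: ifP => _; [exact: hom_deg_gpc t_hom|exact: gpc0].
Qed.

Definition dword w : V := if w is [:: x] then cx_d (lval x) else 0.

Lemma dword_constit : constit dword.
Proof.
have ld := @cx_lin _ V; have [[dd _] _] := cx_diff V.
split; last first.
  move=> [|x [|y w]]; try exact: gpc0.
  by rewrite wdeg_seq1; apply: dd; exact: lval_gpc.
split=> [[|s [|s' u]] [|r v] k x y z|[|s [|s' u]] v x y] /=;
  rewrite ?scaler0 ?addr0 //.
by case=> _ _ ->; exact: ld.
Qed.

Lemma constituent_constit : constit (constituent pd).
Proof. exact: corest_constit pd_hom. Qed.

(* For j = 0 these are the differential d of A, placed at the empty word, and
   that of sL on words of length 1, so that D_zero has the same shape as the
   higher D_ j. *)
Definition tau_ (j : nat) w : Der A :=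
  if j is 0 then (if w is [::] then @cx_d R A else 0) else t_ t j (sprod w).

Definition con_ (j : nat) : seq (letter V) -> V :=
  cmask j.+1 (if j is 0 then dword else constituent pd).

Lemma tau_der j w : gpc (Der A) (wdeg w - 1) (tau_ j w).
Proof.
case: j => [|j]; last exact: hom_deg_gpc (t__hom _).
case: w => [|x w]; last exact: gpc0.
by rewrite wdeg_nil; exact: cx_d_der.
Qed.

Lemma con_constit j : constit (con_ j).
Proof.
apply: cmask_constit; case: j => [|j]; [exact: dword_constit|exact: constituent_constit].
Qed.

Lemma d0_linear : linear (@d0 R L).
Proof. exact: coder_linear dword_constit. Qed.

Lemma d0_sprod w : d0 (sprod w) = cod (con_ 0) w.
Proof. exact: coderE dword_constit. Qed.

Lemma pd__linear j : linear (pd_ pd j).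
Proof. exact: coder_linear constituent_constit. Qed.

Lemma pd__sprod j w : (0 < j)%N -> pd_ pd j (sprod w) = cod (con_ j) w.
Proof. by case: j => // j _; exact: coderE constituent_constit. Qed.

Lemma D_linear j n f : hom_deg n f -> linear (D_ pd t j n f).
Proof.
move=> hf k x y; have lf := hf.1; case: j => [|j].
  rewrite /D_ /D_zero /hom_d d0_linear !lf cx_lin !scalerDr !scalerA.
  by rewrite [_ * k]mulrC addrACA.
rewrite /D_ /pd_t /pd_star !fctE.
rewrite (convolve_linear eval_pairing_bilinear (t__hom _) hf).
rewrite pd__linear lf !scalerDr !scalerA.
by rewrite [_ * k]mulrC addrACA.
Qed.

Lemma D_sprod j n f w : hom_deg n f ->
  D_ pd t j n f (sprod w) = opD (tau_ j) (con_ j) n f w.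
Proof.
move=> hf; have lf := hf.1; rewrite /opD usumD usumZ -(cod_linear _ _ lf).
case: j => [|j].
  rewrite /D_ /D_zero /hom_d d0_sprod usum_unitl => [|[//|x u] v _].
    by rewrite wdeg_nil mulr0 sgn0 scale1r.
  by rewrite /= scaler0.
rewrite /D_ /pd_t /pd_star !fctE pd__sprod //; congr (_ + _).
rewrite convolve_sprod //; [|exact: eval_pairing_bilinear|exact: t__hom].
apply: eq_usum => u v _ _; rewrite /eval_pairing.
by rewrite (lettE (hom_deg_gpc _ (t__hom _))).2 (lettE (hom_deg_gpc _ hf)).2.
Qed.

Lemma D_hom j n f : hom_deg n f -> hom_deg (n - 1) (D_ pd t j n f).
Proof.
move=> hf; apply: hom_deg_sprod; first exact: D_linear.
by move=> w; rewrite D_sprod //; apply: opD_gpc => //; [exact: tau_der|exact: con_constit].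
Qed.

Lemma D_lin j n k f g : hom_deg n f -> hom_deg n g ->
  D_ pd t j n (k *: f + g) = k *: D_ pd t j n f + D_ pd t j n g.
Proof.
move=> hf hg; have hfg := hom_degD k hf hg; apply/funext; apply: eq_linear_sprod.
- exact: D_linear.
- exact: (hom_degD k (D_hom j hf) (D_hom j hg)).1.
by move=> w; rewrite !fctE !D_sprod // opD_lin //; exact: tau_der.
Qed.

Lemma D_glinear j : is_glinear (E := Hom_SA L A) (-1) (D_ pd t j).
Proof. by split=> [i f|i k f g]; [exact: D_hom|exact: D_lin]. Qed.

Lemma D_derivation j : is_derivation (E := Hom_SA L A) (cup (A := A)) (-1) (D_ pd t j).
Proof.
split; first exact: D_glinear.
move=> m n f g hf hg; have hF := D_hom j hf; have hG := D_hom j hg.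
apply/funext; apply: eq_linear_sprod.
- by apply: D_linear; exact: cup_hom.
- have h1 := cup_hom hF hg; have h2 := cup_hom hf hG.
  by move=> k x y; rewrite !fctE h1.1 h2.1 !scalerDr !scalerA [_ * k]mulrC addrACA.
move=> w; rewrite D_sprod; last exact: cup_hom.
rewrite (opD_leibniz (tau_der j) (con_constit j) w hf hg hF hG) // => v;
  by rewrite D_sprod.
Qed.

Lemma act0l y : act 0 y = 0.
Proof. exact: (linear_fun0 (dgm_linl hact y)). Qed.

Lemma act0r (b : A) : act b 0 = 0.
Proof. exact: (linear_fun0 (dgm_linr hact b)). Qed.

Lemma tau_act j u a x b : tau_ j (rcons u (lact act a x)) b =
  sgn (ldeg a * (wdeg u - 1)) *: cmul (lval a) (tau_ j (rcons u x) b).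
Proof.
case: j => [|j].
  have z y : tau_ 0 (rcons u y) b = 0 by case: u.
  by rewrite !z cmul0r scaler0.
have := amultilinear_rcons (shlr_multilinear hLR (ltn0Sn j)) u a x.
by rewrite /tau_ => ->; rewrite fctE /der_act; congr (_ *: _); sgn_solve.
Qed.

(** For j = 0 this is the Leibniz rule of the differential graded module L with the signs of the
    suspension. For j > 0 it is [shlr_leibniz] on words of length j + 1, and all terms vanish in
    other lengths. *)
Lemma con_act j u a x : con_ j (rcons u (lact act a x)) =
  sact act (wdeg u - 1 + ldeg a) (tau_ j u (lval a)) (lval x)
  + sgn ((wdeg u + 1) * ldeg a) *: sact act (ldeg a) (lval a) (con_ j (rcons u x)).
Proof.
case: j => [|j]; rewrite /con_ /cmask !size_rcons eqSS; last first.
  rewrite /tau_ t_sprod; case: eqP => [e|_].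
    by rewrite (shlr_leibniz hLR) e // t_sprod e eqxx.
  by rewrite /sact act0l act0r !scaler0 addr0.
case: u => [|y u] /=; last by rewrite /sact act0l act0r !scaler0 addr0.
rewrite (lval_lact hact) wdeg_nil /= /susp_d /sact.
rewrite (linear_funZ (@cx_lin _ L)) (dgm_d hact _ (lval_gpc a)).
rewrite scalerDr opprD !scalerA; congr (_ + _).
  by rewrite -scaleNr; congr (_ *: _); apply/esym/sgn_opp; par_solve.
rewrite -[- cx_d _]scaleN1r (linear_funZ (dgm_linr hact _)) scalerA mulrN1 scaleNr.
by congr (- (_ *: _)); sgn_solve.
Qed.

Lemma D_sym j n f : sym_deg act n f -> sym_deg act (n - 1) (D_ pd t j n f).
Proof.
move=> sf; have hf := sf.1; split; first exact: D_hom.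
apply: (amultilinear_last hact) => [||u a x]; [exact: D_linear|exact: cmul_linr|].
rewrite !D_sprod //; apply: opD_act => //.
- exact: tau_der.
- exact: con_constit.
- exact: tau_act.
- exact: con_act.
Qed.

Lemma con_eq0 j w : size w != j.+1 -> con_ j w = 0.
Proof. by rewrite /con_ /cmask => /negPf ->. Qed.

Lemma tau_eq0 j w : size w != j -> tau_ j w = 0.
Proof.
case: j => [|j]; first by case: w.
by rewrite /tau_ t_sprod => /negPf ->.
Qed.

End ShLieRinehart.
(** * The total differential *)

Section OperatorSquare.
Context {R : comNzRingType} {L : complex R} {A : cdga R}.
Local Notation V := (susp L).
Local Notation S := (symg V).
Implicit Types (u v w : seq (letter V)).
Context (tau : seq (letter V) -> Der A) (c : seq (letter V) -> V) (delta : S -> S).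
Hypotheses (dtau : forall w, gpc (Der A) (wdeg w - 1) (tau w)) (hc : constit c).
Hypotheses (ldelta : linear delta) (deltaE : forall w, delta (sprod w) = cod c w).
Hypothesis delta_sq : forall w, delta (delta (sprod w)) = 0.
Hypothesis twisting : forall w i a, gpc A i a ->
  unshuffle_sum (fun u v => sgn (wdeg u) *: tau u (tau v a)) w
  + unshuffle_sum (fun u v => tau (clett c u :: v) a) w = 0.

(** [F] stands for D f. Evaluated behind c by the coderivation law, it yields tau(c(u1) u2)(f(v)),
    which meets tau tau f in the twisting equation; the mixed terms tau(u)(f(delta v)) occur twice
    with opposite signs, and f delta delta is zero. *)
Lemma opD_sq n (f F : S -> A) w : hom_deg n f ->
  (forall w, F (sprod w) = opD tau c n f w) -> opD tau c (n - 1) F w = 0.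
Proof.
move=> hf FE; have lf := hf.1.
have opE m (g : S -> A) v : linear g -> opD tau c m g v =
    unshuffle_sum (fun u v => sgn (m * wdeg u) *: tau u (g (sprod v))) v
    + sgn (m + 1) *: g (delta (sprod v)).
  by move=> lg; rewrite /opD usumD usumZ deltaE -cod_linear.
have E1 : unshuffle_sum (fun u v => sgn ((n - 1) * wdeg u) *: tau u (F (sprod v))) w =
    usum3 (fun u v z => sgn ((n - 1) * wdeg u + n * wdeg v) *: tau u (tau v (f (sprod z)))) w
    + unshuffle_sum (fun u v => sgn ((n - 1) * wdeg u + n + 1) *:
        tau u (f (delta (sprod v)))) w.
  rewrite -usumD; apply: eq_usum => u v _ _; have lu := tau_linear dtau u.
  rewrite FE opE // (linear_funD lu) (linear_funZ lu) (usum_linear _ _ lu) scalerDr -usumZ.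
  congr (_ + _); last by rewrite scalerA -sgnD addrA.
  by apply: eq_usum => v1 v2 _ _; rewrite (linear_funZ lu) scalerA -sgnD.
have E2 : unshuffle_sum (fun u v => F (sprod (clett c u :: v))) w =
    unshuffle_sum (fun u v => sgn (n * wdeg u - n) *:
      unshuffle_sum (fun u1 u2 => tau (clett c u1 :: u2) (f (sprod v))) u) w
    + unshuffle_sum (fun u v => sgn (wdeg u + n * wdeg u) *:
        tau u (f (delta (sprod v)))) w.
  transitivity (unshuffle_sum (fun u v => unshuffle_sum
      (fun u v => sgn (n * wdeg u) *: tau u (f (sprod v))) (clett c u :: v)) w
      + sgn (n + 1) *: f (delta (cod c w))).
    rewrite (cod_linear c w (f := fun y => f (delta y))); last first.
      by move=> k y z; rewrite ldelta lf.
    by rewrite -usumZ -usumD; apply: eq_usum => u v _ _; rewrite FE opE.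
  rewrite -deltaE delta_sq (linear_fun0 lf) scaler0 addr0 cod_coderivation // usumD.
  congr (_ + _); apply: eq_usum => u v _ _.
    rewrite -usumZ; apply: eq_usum => u1 u2 e _; rewrite wdeg_cons ldeg_clett // e.
    by congr (_ *: _); sgn_solve.
  have lu := tau_linear dtau u; rewrite deltaE (cod_linear _ _ lf) (usum_linear _ _ lu).
  by rewrite -!usumZ; apply: eq_usum => v1 v2 _ _; rewrite scalerA -sgnD.
rewrite /opD usumD usumZ E1 E2 scalerDr addrACA -[RHS]addr0; congr (_ + _).
  rewrite -usum_coassoc -usumZ -usumD usum_eq0 // => u v _ _.
  transitivity (sgn (n * wdeg u) *: (
    unshuffle_sum (fun u1 u2 => sgn (wdeg u1) *: tau u1 (tau u2 (f (sprod v)))) u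
    + unshuffle_sum (fun u1 u2 => tau (clett c u1 :: u2) (f (sprod v))) u)).
    rewrite scalerDr; congr (_ + _); last by rewrite scalerA; congr (_ *: _); sgn_solve.
    by rewrite -usumZ; apply: eq_usum => u1 u2 -> _; rewrite scalerA; congr (_ *: _); sgn_solve.
  by rewrite (twisting _ (hom_deg_gpc v hf)) scaler0.
rewrite -usumZ -usumD usum_eq0 // => u v _ _; rewrite scalerA -scalerDl.
rewrite -[RHS](scale0r (tau u (f (delta (sprod v))))); congr (_ *: _).
by apply/eqP; rewrite addr_eq0 -sgnD; apply/eqP/sgn_opp; par_solve.
Qed.

End OperatorSquare.

Section Total.
Context {R : comNzRingType} {iota : {rmorphism rat -> R}} {A : cdga R} {L : complex R}.
Context {act : A -> L -> L}.
Context {pd : symg (susp L) -> symg (susp L)} {t : symg (susp L) -> Der A}.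
Hypothesis hLR : is_shLR act iota pd t.
Local Notation V := (susp L).
Local Notation S := (symg V).
Implicit Types (u v w : seq (letter V)) (a : letter A) (x : letter V) (f g : Hom_SA L A).
Local Notation tau_ := (tau_ (t := t)).
Local Notation con_ := (con_ (pd := pd)).

(** The sh Lie condition provides only the square of [d0 + pd]. That [d0] alone squares to zero is
    inherited from L, and the derivation law for the symmetric product reduces this to single
    letters. *)
Lemma d0_lmul x y : d0 (lmul x y) =
  lmul (clett (con_ 0) [:: x]) y + sgn (ldeg x) *: lmul x (d0 y).
Proof.
have hc := con_constit hLR 0.
apply: (@eq_linear_sprod _ _ _ (fun y : S => d0 (lmul x y)) (fun y : S =>
  lmul (clett (con_ 0) [:: x]) y + sgn (ldeg x) *: lmul x (d0 y))) => [k z z'|k z z'|w].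
- by rewrite lmul_linear d0_linear.
- rewrite d0_linear !lmul_linear !scalerDr !scalerA [_ * k]mulrC.
  by rewrite addrACA.
rewrite !lmul_sprod !(d0_sprod (pd := pd)) /cod unshuffle_sum_cons.
congr (_ + _).
  rewrite usum_unitl // => -[//|z u] v _.
  by apply: (clett_hd0 _ sprod_symmultilin).
rewrite (usum_linear _ _ (lmul_linear x)) -usumZ; apply: eq_usum => u v _ _.
rewrite lmul_sprod ((@sprod_symmultilin R V).2 [::]) ldeg_clett // scalerA.
by congr (_ *: _); sgn_solve.
Qed.

Lemma d0_sq w : d0 (d0 (sprod w)) = 0 :> S.
Proof.
have hc := con_constit hLR 0; have l0 := @d0_linear R L.
elim: w => [|x w IH].
  rewrite (d0_sprod (pd := pd)) /cod usum_nil (clett_hd0 _ sprod_symmultilin) //.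
  exact: (linear_fun0 l0).
rewrite -lmul_sprod !(d0_lmul, linear_funD l0, linear_funZ l0) IH.
rewrite (linear_fun0 (lmul_linear x)) scaler0 addr0 -addrA -scalerDl (ldeg_clett hc).
have -> : sgn (wdeg [:: x] - 1) + sgn (ldeg x) = 0 :> R.
  by apply/eqP; rewrite addr_eq0 wdeg_seq1; apply/eqP/sgn_opp; par_solve.
rewrite scale0r addr0 lmul_sprod (clett_hd0 _ sprod_symmultilin) //=.
rewrite /con_ /cmask /= (lval_clett hc) /=.
exact: (diff_sq (cx_diff V) (lval_gpc x)).
Qed.

Lemma D_zero_sq n f : hom_deg n f -> D_ pd t 0 (n - 1) (D_ pd t 0 n f) = 0.
Proof.
move=> hf; apply/funext; apply: eq_linear_sprod => [||w].
- exact/(D_linear hLR)/(D_hom hLR).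
- by move=> k y z; rewrite scaler0 addr0.
rewrite /D_ /D_zero /hom_d (linear_funD (@cx_lin _ A)) (linear_funZ (@cx_lin _ A)) d0_sq.
rewrite (linear_fun0 hf.1) scaler0 addr0 (diff_sq (cx_diff A) (hom_deg_gpc w hf)) add0r.
rewrite -scalerDl -[RHS](scale0r (cx_d (f (d0 (sprod w))))); congr (_ *: _).
by apply/eqP; rewrite addr_eq0; apply/eqP/sgn_opp; par_solve.
Qed.

(* Each word u is seen by exactly one tau_ j and by at most one con_ j. *)
Definition tauT u : Der A := tau_ (size u) u.
Definition conT u : V := con_ (size u).-1 u.

Lemma tauT_gpc w : gpc (Der A) (wdeg w - 1) (tauT w).
Proof. exact: (tau_der hLR). Qed.

Lemma tauTE u : tauT u = t (sprod u) + tau_ 0 u.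
Proof.
rewrite /tauT; case: u => [|x u].
  by rewrite (shact_coaug (shlr_shaction hLR)) add0r.
by rewrite /= (t_sprod hLR) eqxx addr0.
Qed.

(** Since [pd] lowers the coaugmentation filtration, a word of length at most 1 is sent into length
    0, where [corest] vanishes. The constituents of [pd] and the differential of L thus live on
    disjoint lengths. *)
Lemma constituent_short u : (size u <= 1)%N -> constituent pd u = 0.
Proof.
move=> hu; rewrite /constituent.
have : coaug ((size u)%:Z - 1) (pd (sprod u)).
  apply: (shl_lower (shlr_shLie hLR)); exists [:: (1, u)].
  by split=> [p|]; [rewrite inE => /eqP ->|rewrite big_seq1 scale1r].
case=> s [hs ->]; have [lc _] := @corest_hom R V.
rewrite (linear_fun_sum lc) big_seq big1 // => p ps.
rewrite (linear_funZ lc) corest_sprod; have := hs p ps.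
case: p.2 => [|x [|y w]] /=; rewrite ?scaler0 //.
by move: hu; case: (size u) => [|[|n]].
Qed.

Lemma conTE u : conT u = constituent pd u + con_ 0 u.
Proof.
rewrite /conT; case: u => [|x [|y u]]; last by rewrite /con_ /cmask /= eqxx addr0.
  by rewrite constituent_short // add0r.
by rewrite constituent_short // add0r.
Qed.

Lemma conT_constit : constit conT.
Proof.
have [[h1 h2] h3] := constituent_constit hLR; have [[k1 k2] k3] := con_constit hLR 0.
split; last by move=> w; rewrite conTE; apply: gpcDr.
split=> [u v k x y z h|u v x y]; rewrite !conTE.
  by rewrite (h1 _ _ _ _ _ _ h) (k1 _ _ _ _ _ _ h) scalerDr addrACA.
by rewrite h2 k2 scalerDr.
Qed.

Lemma cod_conT w : cod conT w = d0 (sprod w) + pd (sprod w).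
Proof.
have hp := constituent_constit hLR; have h0 := con_constit hLR 0.
rewrite (coderivation_cod iota (pd_hom hLR) (shl_coder (shlr_shLie hLR))).
rewrite (d0_sprod (pd := pd)) addrC /cod -usumD; apply: eq_usum => u v _ _.
rewrite /clett conTE; apply: (symmultilin_hdD _ sprod_symmultilin).
  exact: hp.2.
exact: h0.2.
Qed.

Lemma d0pd_linear : linear (fun y : S => d0 y + pd y).
Proof. by move=> k y z; rewrite d0_linear (pd_hom hLR).1 scalerDr addrACA. Qed.

(** The two halves of the graded commutator contribute equal sums by cocommutativity, and the factor
    1/2 absorbs the doubling. *)
Lemma wedge_sprod w (b : A) : wedge iota t (sprod w) b =
  unshuffle_sum (fun u v => sgn (wdeg u) *: t (sprod u) (t (sprod v) b)) w.
Proof.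
have ht := t_hom hLR.
pose Z := unshuffle_sum (fun u v => sgn (wdeg u) *: t (sprod u) (t (sprod v) b)) w.
transitivity (iota 2%:R^-1 *: (Z + Z)); last first.
  have h : iota 2%:R^-1 * 2%:R = 1 by rewrite -(rmorph_nat iota) -rmorphM mulVf // rmorph1.
  by rewrite -mulr2n -scaler_nat scalerA h scale1r.
rewrite /wedge !fctE; congr (_ *: _).
rewrite convolve_sprod //; last exact: der_bracket_bilinear.
rewrite (@usum_linear _ _ _ _ (fun h : Der A => h b)) //.
rewrite {2}/Z [X in _ = Z + X]usum_cocomm -usumD; apply: eq_usum => u v _ _.
have lE z : lval (lett (wdeg z - 1) (t (sprod z)) : letter (Der A)) = t (sprod z).
  exact: (lettE (hom_deg_gpc z ht)).2.
have dE z : ldeg (lett (wdeg z - 1) (t (sprod z)) : letter (Der A)) = wdeg z - 1.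
  exact: (lettE (hom_deg_gpc z ht)).1.
rewrite fctE /der_bracket !lE !dE scalerDr. congr (_ *: _ + _); first by sgn_solve.
rewrite scalerN !scalerA -scaleNr; congr (_ *: _); rewrite -!sgnD.
by apply/esym/sgn_opp; par_solve.
Qed.

(** [tauT] is t with the differential d of A added at the empty word. The terms with u or v empty
    supply d t and t d, so the Maurer-Cartan equation of t results, up to d d = 0. *)
Lemma tauT_twisting w i (b : A) : gpc A i b ->
  unshuffle_sum (fun u v => sgn (wdeg u) *: tauT u (tauT v b)) w
  + unshuffle_sum (fun u v => tauT (clett conT u :: v) b) w = 0.
Proof.
move=> hb; have lt u : linear (t (sprod u)) by have [[]] := hom_deg_gpc u (t_hom hLR).
have MC := shact_MC (shlr_shaction hLR) (sprod_deg w).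
move/(congr1 (fun h : Der A => h b)): MC; rewrite !fctE wedge_sprod => MC.
rewrite -[RHS]MC -cod_conT (cod_linear _ _ (t_hom hLR).1).
rewrite (@usum_linear _ _ _ _ (fun h : Der A => h b)) //.
rewrite [RHS]addrAC; congr (_ + _); last first.
  by apply: eq_usum => u v _ _; rewrite tauTE fctE addr0.
transitivity (unshuffle_sum (fun u v => sgn (wdeg u) *: t (sprod u) (t (sprod v) b)
   + sgn (wdeg u) *: t (sprod u) (tau_ 0 v b)
   + sgn (wdeg u) *: tau_ 0 u (tauT v b)) w).
  apply: eq_usum => u v _ _; rewrite [tauT u]tauTE fctE scalerDr; congr (_ + _).
  by rewrite tauTE fctE (linear_funD (lt u)) scalerDr.
rewrite !usumD [X in _ + X + _]usum_unitr => [|u [//|x v] _]; last first.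
  by rewrite (linear_fun0 (lt u)) scaler0.
rewrite [X in _ + _ + X]usum_unitl => [|[//|x u] v _]; last by rewrite scaler0.
rewrite addrC addrCA [RHS]addrC; congr (_ + _).
  by congr (_ + _ *: _); sgn_solve.
rewrite wdeg_nil sgn0 scale1r /= tauTE fctE (linear_funD (@cx_lin _ A)).
have -> : cx_d (tau_ 0 w b) = 0 :> A; last by rewrite addr0.
case: w {MC} => [|x w] /=; first exact: (diff_sq (cx_diff A) hb).
exact: (linear_fun0 (@cx_lin _ A)).
Qed.

End Total.
(** * The multi derivation chain algebra *)

Section Assembly.
Context {R : comNzRingType} {iota : {rmorphism rat -> R}} {A : cdga R} {L : complex R}.
Context {act : A -> L -> L}.
Context {pd : symg (susp L) -> symg (susp L)} {t : symg (susp L) -> Der A}.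
Hypothesis hLR : is_shLR act iota pd t.
Local Notation V := (susp L).
Local Notation S := (symg V).
Implicit Types (u v w : seq (letter V)) (a : letter A) (x : letter V) (f g : Hom_SA L A).
Local Notation tau_ := (tau_ (t := t)).
Local Notation con_ := (con_ (pd := pd)).
Local Notation tauT := (tauT (t := t)).
Local Notation conT := (conT (pd := pd)).
Local Notation E := (Sym act).
Local Notation F := (Sym_filt (act := act)).

(** * The sum of the D_j on words *)

Lemma sum_at (M : zmodType) N j0 (G : nat -> M) : (j0 < N)%N ->
  (forall j, j != j0 -> G j = 0) -> \sum_(j < N) G j = G j0.
Proof.
move=> h G0; rewrite (bigD1 (Ordinal h)) //= big1 ?addr0 // => j hj.
by rewrite G0 //; apply: contra hj => /eqP e; apply/eqP/val_inj.
Qed.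

(** An unshuffle (u, v) of w meets [tau_ j] only for j = |u| and [con_ j] only for j + 1 = |u|, so
    the sum is stationary as soon as N exceeds |w|. *)
Lemma opD_sum n f w N : linear f -> (size w < N)%N ->
  \sum_(j < N) opD (tau_ j) (con_ j) n f w = opD tauT conT n f w.
Proof.
move=> lf hN; have hF := linear_symmultilin lf.
rewrite /opD /unshuffle_sum exchange_big /= !big_seq.
apply: eq_bigr => p /unshuffle_inv[_ hs]; rewrite -scaler_sumr big_split /=.
have h1 : (size p.2.1 < N)%N by apply: leq_ltn_trans hN; rewrite -hs leq_addr.
have h2 : ((size p.2.1).-1 < N)%N := leq_ltn_trans (leq_pred _) h1.
congr (_ *: (_ + _)).
  apply: (sum_at (G := fun j => sgn (n * wdeg p.2.1) *: tau_ j p.2.1 (f (sprod p.2.2))) h1) => j hj.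
  by rewrite (tau_eq0 hLR) ?scaler0 // eq_sym.
rewrite (sum_at (G := fun j => sgn (n + 1) *: f (sprod (clett (con_ j) p.2.1 :: p.2.2))) h2) //.
move=> j hj; rewrite (clett_hd0 _ hF) ?scaler0 // con_eq0 //.
by apply: contra hj => /eqP ->.
Qed.

Lemma partial_sum_sprod n f w N : hom_deg n f -> (size w < N)%N ->
  partial_sum (E := Hom_SA L A) (D_ pd t) n f N (sprod w) = opD tauT conT n f w.
Proof.
move=> hf hN; rewrite -(opD_sum n hf.1 hN) /partial_sum fct_sumE.
by apply: eq_bigr => j _; rewrite (D_sprod hLR).
Qed.

Lemma partial_sum_sym n f N : sym_deg act n f ->
  sym_deg act (n - 1) (partial_sum (E := Hom_SA L A) (D_ pd t) n f N).
Proof.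
move=> sf; apply: (@gpc_sum _ E (n - 1) _ _ (fun j : 'I_N => D_ pd t j n f)) => j _.
exact: (D_sym hLR).
Qed.

Lemma partial_sum_hom n f N : hom_deg n f ->
  hom_deg (n - 1) (partial_sum (E := Hom_SA L A) (D_ pd t) n f N).
Proof.
move=> sf; apply: (@gpc_sum _ (Hom_SA L A) (n - 1) _ _ (fun j : 'I_N => D_ pd t j n f)) => j _.
exact: (D_hom hLR).
Qed.

(** The limit of a sequence of forms that is stationary in each length. It is well defined because
    the relations of the symmetric algebra preserve length. *)
Definition diagonal_form (h : nat -> S -> A) : S -> A :=
  linext (fun w => h (size w) (sprod w)).

Lemma diagonal_symmultilin (h : nat -> S -> A) : (forall N, linear (h N)) ->
  symmultilin (fun w => h (size w) (sprod w)).
Proof.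
move=> lh; split=> [u v k x y z e|u v x y].
  have [hl _] := linear_symmultilin (lh (size (u ++ x :: v))).
  by have := hl _ _ _ _ _ _ e; rewrite !size_cat.
have [_ hc] := linear_symmultilin (lh (size (u ++ [:: x, y & v]))).
by have := hc u v x y; rewrite !size_cat.
Qed.

Lemma diagonal_sprod (h : nat -> S -> A) w : (forall N, linear (h N)) ->
  diagonal_form h (sprod w) = h (size w) (sprod w).
Proof. by move=> lh; exact: linext_sprod (diagonal_symmultilin lh). Qed.

Lemma diagonal_sym n (h : nat -> S -> A) : (forall N, sym_deg act n (h N)) ->
  sym_deg act n (diagonal_form h).
Proof.
move=> sh; have lh N : linear (h N) := (sh N).1.1.
split=> [|u v a x].
  apply: hom_deg_sprod; first exact: linext_sym_linear (diagonal_symmultilin lh).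
  by move=> w; rewrite diagonal_sprod //; exact: hom_deg_gpc (sh _).1.
by rewrite !diagonal_sprod // !size_cat (sh _).2.
Qed.

(** Words of length N meet the indices 0, ..., N, hence the N + 1 summands. *)
Definition totalD n f : Hom_SA L A :=
  diagonal_form (fun N => partial_sum (E := Hom_SA L A) (D_ pd t) n f N.+1).

Lemma totalD_sprod n f w : hom_deg n f -> totalD n f (sprod w) = opD tauT conT n f w.
Proof.
move=> hf; rewrite /totalD diagonal_sprod => [|N].
  by rewrite partial_sum_sprod.
exact: (partial_sum_hom _ hf).1.
Qed.

Lemma totalD_sym n f : sym_deg act n f -> sym_deg act (n - 1) (totalD n f).
Proof. by move=> sf; apply: diagonal_sym => N; exact: partial_sum_sym. Qed.

Lemma totalD_differential : is_differential (E := E) totalD.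
Proof.
split; first split.
- exact: totalD_sym.
- move=> n k f g sf sg; have sfg := sym_degD k sf sg.
  apply/funext; apply: eq_linear_sprod => [||w].
  + exact: (totalD_sym sfg).1.1.
  + exact: (sym_degD k (totalD_sym sf) (totalD_sym sg)).1.1.
  rewrite !fctE !totalD_sprod ?sfg.1 //; [|exact: sg.1|exact: sf.1|exact: sfg.1].
  by rewrite opD_lin //; exact: (tauT_gpc hLR).
move=> n f sf; have sT := totalD_sym sf.
apply/funext; apply: eq_linear_sprod => [||w].
- exact: (totalD_sym sT).1.1.
- by move=> k y z; rewrite scaler0 addr0.
rewrite totalD_sprod; last exact: sT.1.
transitivity (0 : A) => //.
apply: (@opD_sq _ _ _ _ _ (fun y : S => d0 y + pd y) (tauT_gpc hLR) (conT_constit hLR)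
  (d0pd_linear hLR) _ _ (@tauT_twisting _ _ _ _ _ _ _ hLR) n f _ w sf.1).
- by move=> v; rewrite (cod_conT hLR).
- by move=> v; exact: (shl_sq (shlr_shLie hLR)).
- by move=> v; rewrite totalD_sprod //; exact: sf.1.
Qed.

Lemma Sym_filtP l (f : S -> A) : linear f ->
  Sym_filt (act := act) l f <-> (forall w, (size w < l)%N -> f (sprod w) = 0).
Proof.
move=> lf; split=> [h w hw|h x [s [hs ->]]].
  apply: h; exists [:: (1, w)].
  by split=> [p|]; [rewrite inE => /eqP ->; move: hw; rewrite /=; lia|rewrite big_seq1 scale1r].
rewrite (linear_fun_sum lf) big_seq big1 // => p ps; rewrite (linear_funZ lf) h ?scaler0 //.
by move: (hs p ps); case: (size p.2) => *; lia.
Qed.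

(** On a word shorter than l + j, |u| = j leaves |v| < l, and |u| = j + 1 leaves the word c(u) v of
    length 1 + |v| < l. *)
Lemma D_filt j l n f : sym_deg act n f -> F l f -> F (l + j)%N (D_ pd t j n f).
Proof.
move=> sf /(Sym_filtP _ sf.1.1) hl.
apply/Sym_filtP => [|w hw]; first exact: (D_linear hLR j sf.1).
rewrite (D_sprod hLR) ?sf.1 //; last exact: sf.1.
apply: usum_eq0 => u v _ hs.
have -> : tau_ j u (f (sprod v)) = 0.
  have [e|ne] := eqVneq (size u) j; last by rewrite (tau_eq0 hLR).
  rewrite hl; last by lia.
  exact: (linear_fun0 (tau_linear (tau_der hLR j) u)).
have -> : f (sprod (clett (con_ j) u :: v)) = 0; last by rewrite !scaler0 addr0.
have [e|ne] := eqVneq (size u) j.+1.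
  by apply: hl; move: hw; rewrite hs e addSnnS addnC ltn_add2r.
by rewrite (clett_hd0 _ (linear_symmultilin sf.1.1)) // con_eq0.
Qed.

Lemma Sym_filtration : is_filtration (E := E) (D_ pd t) F.
Proof.
split.
- by [].
- move=> l n k f g sf sg hf hg x hx; transitivity (k *: (f x : A) + g x) => //.
  by rewrite (hf x hx) (hg x hx) scaler0 addr0.
- by move=> n f sf; apply/Sym_filtP => //; exact: sf.1.1.
- move=> l n f sf /(Sym_filtP _ sf.1.1) h; apply/Sym_filtP; first exact: sf.1.1.
  by move=> w hw; apply: h; lia.
- by move=> l n f sf hf; rewrite -[l]addn0; exact: D_filt.
Qed.

Lemma Sym_complete : filt_complete (E := E) F.
Proof.
split=> [n f sf hf|n h sh hc].
  apply/funext; apply: eq_linear_sprod => [||w]; first exact: sf.1.1.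
    by move=> k y z; rewrite scaler0 addr0.
  exact: ((Sym_filtP _ sf.1.1).1 (hf (size w).+1)).
have [N hN] := choice hc; have lh k : linear (h k) := (sh k).1.1.
(* The moduli [N] need not be monotone; [b l] dominates those up to l. *)
pose b l := \max_(i < l.+1) N i.
have hb i l : (i <= l)%N -> (N i <= b l)%N.
  by rewrite -ltnS => hi; exact: (leq_bigmax (Ordinal hi)).
have st i k k' w : (size w < i)%N -> (N i <= k)%N -> (N i <= k')%N ->
    h k (sprod w) = h k' (sprod w).
  have e k0 : (size w < i)%N -> (N i <= k0)%N -> h k0 (sprod w) = h (N i) (sprod w).
    move=> hw hk; have := hN i k0 hk; rewrite Sym_filtP => [/(_ w hw)|].
      by rewrite !fctE => /eqP; rewrite subr_eq0 => /eqP.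
    by have := sym_degD (-1) (sh (N i)) (sh k0); rewrite scaleN1r addrC => -[[]].
  by move=> hw hk hk'; rewrite e // [RHS]e.
exists (diagonal_form (fun l => h (b l.+1))).
  by apply: diagonal_sym => l; exact: sh.
have sd := @diagonal_sym n (fun l => h (b l.+1)) (fun l => sh _).
move=> l; exists (N l) => k hk; apply/Sym_filtP.
  by have := sym_degD (-1) (sh k) sd; rewrite scaleN1r addrC => -[[]].
move=> w hw; rewrite !fctE diagonal_sprod //; apply/eqP; rewrite subr_eq0; apply/eqP.
rewrite (@st (size w).+1 _ (maxn (b (size w).+1) (b l)) w) //; last first.
- by rewrite leq_max hb.
- exact: hb.
by apply: (@st l) => //; rewrite leq_max (hb l l) ?orbT.
Qed.

(** Nothing bounds the j with D_j f nonzero, so the sum is taken in the filtration topology. *)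
Lemma totalD_is_sum : is_sum (E := E) (D_ pd t) F totalD.
Proof.
right; split; first exact: Sym_complete.
move=> n f sf l; exists l => k hk; apply/Sym_filtP.
  have := sym_degD (-1) (partial_sum_sym k sf) (totalD_sym sf).
  by rewrite scaleN1r [- _ + _]addrC => -[[]].
move=> w hw; rewrite !fctE totalD_sprod; last exact: sf.1.
rewrite -(partial_sum_sprod (N := k) sf.1); last by lia.
exact: subrr.
Qed.

(** * Test forms and strictness *)

Definition const_form (b : A) : S -> A :=
  linext (fun w => if w is [::] then b else 0).

Lemma const_symmultilin (b : A) :
  symmultilin (fun w => if w is [::] then b else 0).
Proof. by split=> [[|s u] v k x y z|[|s u] v x y] /=; rewrite ?scaler0 ?addr0. Qed.

Lemma const_sprod (b : A) w : const_form b (sprod w) = if w is [::] then b else 0.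
Proof. exact: linext_sprod (const_symmultilin b). Qed.

Lemma const_sym i (b : A) : gpc A i b -> sym_deg act i (const_form b).
Proof.
move=> hb; split=> [|u v a x]; last first.
  by rewrite !const_sprod; case: u => [|y u] /=; rewrite cmul0r scaler0.
apply: hom_deg_sprod; first exact: linext_sym_linear (const_symmultilin b).
move=> [|x w]; rewrite const_sprod; last exact: gpc0.
by rewrite wdeg_nil add0r.
Qed.

(** The words v are absorbed into f, so that A-multilinearity in the remaining letter comes from
    that of f; no other linear form on sL is known to exist. *)
Definition slot_form f v : S -> A :=
  linext (fun w => if w is [:: x] then f (sprod (rcons v x)) else 0).

Lemma slot_symmultilin f v : linear f ->
  symmultilin (fun w => if w is [:: x] then f (sprod (rcons v x)) else 0).
Proof.
move=> lf; have [hl _] := linear_symmultilin lf.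
split=> [[|s [|s' u]] [|r z] k x y x'|[|s [|s' u]] z x y] /=;
  rewrite ?scaler0 ?addr0 //.
by move=> h; rewrite -!cats1; exact: hl.
Qed.

Lemma slot_sprod f v w : linear f ->
  slot_form f v (sprod w) = if w is [:: x] then f (sprod (rcons v x)) else 0.
Proof. by move=> lf; exact: linext_sprod (slot_symmultilin v lf). Qed.

Lemma slot_sym n f v : sym_deg act n f -> sym_deg act (n + wdeg v) (slot_form f v).
Proof.
move=> sf; have lf := sf.1.1; split=> [|u z a x].
  apply: hom_deg_sprod; first exact: linext_sym_linear (slot_symmultilin v lf).
  move=> [|x [|y w]]; rewrite slot_sprod //; try exact: gpc0.
  have := hom_deg_gpc (rcons v x) sf.1; rewrite wdeg_rcons wdeg_seq1.
  by congr (gpc A _ _); ring.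
rewrite !slot_sprod //; case: u z => [|y [|y' u]] [|z' z] /=;
  rewrite ?cmul0r ?scaler0 //.
by rewrite (amultilinear_rcons sf.2) wdeg_nil addr0.
Qed.

Lemma D_strict j : (0 < j)%N ->
  (exists n f, sym_deg act n f /\ D_ pd t j n f <> 0) ->
  ~ lowers_by (E := E) F j.+1 (D_ pd t j).
Proof.
move=> hj [n [f [sf nz]]] low; apply: nz; have lf := sf.1.1.
have tau0 u i (b : A) : gpc A i b -> tau_ j u b = 0.
  move=> hb; have sb := const_sym hb.
  have [e|ne] := eqVneq (size u) j; last by rewrite (tau_eq0 hLR).
  (* The image must vanish on words of length j, where only the unshuffle with empty right part
     reaches the constant. *)
  have : F (0 + j.+1)%N (D_ pd t j i (const_form b)).
    by apply: low => //; apply/Sym_filtP => //; exact: sb.1.1.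
  rewrite Sym_filtP; last exact: (D_linear hLR j sb.1).
  move/(_ u); rewrite e (D_sprod hLR) ?sb.1 //; last exact: sb.1.
  move/(_ (ltnSn _)); rewrite /opD usum_unitr => [|p q hq].
    by rewrite !const_sprod scaler0 addr0 => /(congr1 (fun z => sgn (i * wdeg u) *: z));
      rewrite scaler_sgnK scaler0.
  rewrite !const_sprod scaler0 addr0; case: q hq => // s q _.
  by rewrite (linear_fun0 (tau_linear (tau_der hLR j) p)) scaler0.
have con0 u v : f (sprod (clett (con_ j) u :: v)) = 0.
  have sg := slot_sym v sf.
  have [e|ne] := eqVneq (size u) j.+1; last first.
    by rewrite (clett_hd0 _ (linear_symmultilin lf)) // con_eq0.
  (* A linear form vanishes on the empty word, so it has filtration 1; its image must then vanish on
     words of length j + 1, exactly those that carry [con_ j]. *)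
  have : F (1 + j.+1)%N (D_ pd t j (n + wdeg v) (slot_form f v)).
    apply: low => //; apply/Sym_filtP; first exact: sg.1.1.
    by move=> [|x w] // _; rewrite slot_sprod.
  rewrite Sym_filtP; last exact: (D_linear hLR j sg.1).
  move/(_ u); rewrite e (D_sprod hLR) ?sg.1 //; last exact: sg.1.
  move/(_ (ltnSn _)); rewrite /opD usum_unitr => [|p q hq].
    rewrite (tau0 _ _ _ (hom_deg_gpc [::] sg.1)) scaler0 add0r slot_sprod //.
    move/(congr1 (fun z => sgn (n + wdeg v + 1) *: z)); rewrite scaler_sgnK scaler0 => z0.
    by rewrite (symmultilin_rcons _ _ (linear_symmultilin lf)) z0 scaler0.
  rewrite (tau0 _ _ _ (hom_deg_gpc q sg.1)) slot_sprod //.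
  by case: q hq => // s q _; rewrite !scaler0 addr0.
apply/funext; apply: eq_linear_sprod => [||w].
- exact: (D_linear hLR j sf.1).
- by move=> k y z; rewrite scaler0 addr0.
rewrite (D_sprod hLR) ?sf.1 //; last exact: sf.1.
by apply: usum_eq0 => u v _ _; rewrite con0 (tau0 _ _ _ (hom_deg_gpc v sf.1)) !scaler0 addr0.
Qed.

(** * The algebra of multilinear forms *)

Lemma cup_assoc i j k f g (h : Hom_SA L A) : hom_deg i f -> hom_deg j g -> hom_deg k h ->
  cup i (j + k) f (cup j k g h) = cup (i + j) k (cup i j f g) h.
Proof.
move=> hf hg hh; have hgh := cup_hom hg hh; have hfg := cup_hom hf hg.
apply/funext; apply: eq_linear_sprod => [||w]; try exact: cup_linear.
rewrite !cup_sprod //.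
transitivity (usum3 (fun u v z => sgn ((j + k) * wdeg u + k * wdeg v) *:
    cmul (f (sprod u)) (cmul (g (sprod v)) (h (sprod z)))) w).
  apply: eq_usum => u v _ _; rewrite cup_sprod // (usum_linear _ _ (cmul_linr _)) -usumZ.
  by apply: eq_usum => p q _ _; rewrite cmulZr scalerA -sgnD.
rewrite -usum_coassoc; apply: eq_usum => u v _ _.
rewrite cup_sprod // (usum_linear _ _ (cmul_linl _)) -usumZ.
apply: eq_usum => p q -> _; rewrite cmulZl scalerA.
rewrite (gcalg_assoc (cdga_alg (cdgaP A)) (hom_deg_gpc p hf) (hom_deg_gpc q hg)
  (hom_deg_gpc v hh)).
by congr (_ *: _); sgn_solve.
Qed.

Lemma Sym_gcalgebra : is_gcalgebra (E := E) (cup (A := A)) (cup_one A).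
Proof.
(* [cup_one] unfolds to the constant form at [cone]. *)
have oneE w : cup_one (L := L) A (sprod w) = if w is [::] then cone else 0.
  exact: const_sprod.
have one_sym : sym_deg act 0 (cup_one A).
  exact: const_sym (gcalg_one (cdga_alg (cdgaP A))).
have one_hom : hom_deg 0 (cup_one A) := one_sym.1.
split.
- move=> m n f g; exact: (cup_sym (shlr_module hLR)).
- move=> i j k f f' g [hf _] [hf' _] [hg _]; have hff := hom_degD k hf hf'.
  apply/funext; apply: eq_linear_sprod => [||w]; first exact: cup_linear.
    exact: (hom_degD k (cup_hom hf hg) (cup_hom hf' hg)).1.
  transitivity (k *: (cup i j f g (sprod w) : A) + cup i j f' g (sprod w)) => //.
  rewrite !cup_sprod //.
  rewrite -usumZ -usumD; apply: eq_usum => u v _ _.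
  by rewrite !fctE cmul_linl scalerDr !scalerA mulrC.
- move=> i j k f g g' [hf _] [hg _] [hg' _]; have hgg := hom_degD k hg hg'.
  apply/funext; apply: eq_linear_sprod => [||w]; first exact: cup_linear.
    exact: (hom_degD k (cup_hom hf hg) (cup_hom hf hg')).1.
  transitivity (k *: (cup i j f g (sprod w) : A) + cup i j f g' (sprod w)) => //.
  rewrite !cup_sprod //.
  rewrite -usumZ -usumD; apply: eq_usum => u v _ _.
  by rewrite !fctE cmul_linr scalerDr !scalerA mulrC.
- by move=> i j k f g h [hf _] [hg _] [hh _]; exact: cup_assoc.
- exact: one_sym.
- move=> i f [hf _]; apply/funext; apply: eq_linear_sprod => [||w].
  + exact: cup_linear.
  + exact: hf.1.
  rewrite cup_sprod // usum_unitl => [|u v hu].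
    rewrite wdeg_nil mulr0 sgn0 scale1r oneE.
    exact: (gcalg_unit (cdga_alg (cdgaP A)) (hom_deg_gpc w hf)).
  by rewrite oneE; case: u hu => // s u _; rewrite cmul0l scaler0.
move=> i j f g [hf _] [hg _]; apply/funext; apply: eq_linear_sprod => [||w].
- exact: cup_linear.
- move=> k y z; rewrite !fctE (cup_linear hg hf) scalerDr !scalerA [_ * k]mulrC.
  by [].
rewrite fctE !cup_sprod // usum_cocomm -usumZ; apply: eq_usum => u v _ _.
rewrite (gcalg_comm (cdga_alg (cdgaP A)) (hom_deg_gpc v hf) (hom_deg_gpc u hg)).
by rewrite !scalerA; congr (_ *: _); sgn_solve.
Qed.

Lemma Sym_derivation j : is_derivation (E := E) (cup (A := A)) (-1) (D_ pd t j).
Proof.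
split; first split.
- by move=> n f; exact: (D_sym hLR).
- by move=> n k f g [hf _] [hg _]; exact: (D_lin hLR).
- by move=> m n f g [hf _] [hg _]; exact: (der_leibniz (D_derivation hLR j)).
Qed.

Lemma Sym_cdga : is_cdga (E := E) (cup (A := A)) (cup_one A) (D_ pd t 0).
Proof.
split; [exact: Sym_gcalgebra|exact: Sym_derivation|].
split; first exact: der_linear (Sym_derivation 0).
by move=> n f [hf _]; exact: (D_zero_sq hLR).
Qed.

End Assembly.

Theorem theorem5p11 (R : comNzRingType) (iota : {rmorphism rat -> R})
    (A : cdga R) (L : complex R) (act : A -> L -> L)
    (pd : symg (susp L) -> symg (susp L)) (t : symg (susp L) -> Der A)
    (hLR : is_shLR act iota pd t) :
  (forall j : nat, (0 < j)%N ->
     is_derivation (E := Hom_SA L A) (cup (A := A)) (-1) (D_ pd t j) /\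
     (forall (n : int) (f : Hom_SA L A),
        gpc (Sym act) n f -> gpc (Sym act) (n - 1) (D_ pd t j n f))) /\
  is_multi_derivation_chain_algebra (E := Sym act) (cup (A := A)) (cup_one A) (D_ pd t)
    (Sym_filt (act := act)).
Proof.
split=> [j _|].
  by split; [exact: (D_derivation hLR)|move=> n f; exact: (D_sym hLR)].
split.
- exact: (Sym_cdga hLR).
- exact: (Sym_filtration hLR).
- by move=> j _; exact: (Sym_derivation hLR).
- by move=> j _ l n f; exact: (D_filt hLR).
- by move=> j; exact: (D_strict hLR).
- by exists (totalD (pd := pd) (t := t)); split;
    [exact: (totalD_is_sum hLR)|exact: (totalD_differential hLR)].
Qed.
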